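(* Let $(X,d)$ be a metric space and $\phi:X\to(-\infty,+\infty]$ a proper lower semicontinuous functional. Suppose that $\mathrm{Dom}(\phi)$ is an approximate length subset of $X$ and that for some $\lambda\le0$ the $\mathrm{EVI}_\lambda$-gradient flow $\mathsf S_t$ of $\phi$ exists in $\overline{\mathrm{Dom}(\phi)}$. If, for some $\tau>0$ and $\eta\ge0$ satisfying $4\gamma\tau\le1$, where $\gamma:=2\eta-3\lambda$, the sequence $(U^n_{\tau,\eta})_{n\in\mathbb N}\subset\mathrm{Dom}(\phi)$ is a $(\tau,\eta)$-discrete Minimizing Movement, then for all $u_0\in\overline{\mathrm{Dom}(\phi)}$ the following estimate holds: $$d\big(\mathsf S_t(u_0),\overline U_{\tau,\eta}(t)\big)\le e^{-\lambda t}d(u_0,U^0_{\tau,\eta})+\big(\sqrt{\tau t_\tau}+t_\tau-t\big)e^{\gamma t_\tau}|\partial\phi|(U^0_{\tau,\eta})\quad\text{for every }t>0.$$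
   Context: $\mathrm{Dom}(\phi):=\{x\in X:\phi(x)<+\infty\}$. Metric slope: $|\partial\phi|(x):=+\infty$ if $x\notin\mathrm{Dom}(\phi)$; $:=0$ if $x\in\mathrm{Dom}(\phi)$ is isolated; $:=\limsup_{y\to x}\frac{(\phi(x)-\phi(y))^+}{d(x,y)}$ otherwise. $D\subset X$ is an approximate length subset if for every $x_0,x_1\in D$ and $\varepsilon\in(0,1)$ there is $x\in D$ with $d^2(x_0,x)+d^2(x,x_1)\le\frac12d^2(x_0,x_1)(1+\varepsilon^2/4)$. A $(\tau,\eta)$-discrete Minimizing Movement starting from $U^0_{\tau,\eta}\in\mathrm{Dom}(\phi)$ is a sequence $(U^n_{\tau,\eta})_{n\in\mathbb N}$ in $\mathrm{Dom}(\phi)$ such that for every $n\ge1$ $$\tfrac1{2\tau}d^2(U^n_{\tau,\eta},U^{n-1}_{\tau,\eta})+\phi(U^n_{\tau,\eta})\le\tfrac1{2\tau}d^2(V,U^{n-1}_{\tau,\eta})+\phi(V)+\tfrac\eta2\,d(U^n_{\tau,\eta},U^{n-1}_{\tau,\eta})\,d(V,U^n_{\tau,\eta})\quad\text{for every }V\in\mathrm{Dom}(\phi),$$ $$\tfrac1{2\tau}d^2(U^n_{\tau,\eta},U^{n-1}_{\tau,\eta})+\phi(U^n_{\tau,\eta})\le\phi(U^{n-1}_{\tau,\eta}).$$ Its piecewise constant interpolant is $\overline U_{\tau,\eta}(t):=U^n_{\tau,\eta}$ if $t\in((n-1)\tau,n\tau]$, $\overline U_{\tau,\eta}(0):=U^0_{\tau,\eta}$.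 $t_\tau:=\min\{k\tau:k\in\mathbb N,\ k\tau\ge t\}$. With $\frac{\mathrm d}{\mathrm dt}^{+}\zeta(t):=\limsup_{h\downarrow0}\frac{\zeta(t+h)-\zeta(t)}h$, a solution of $\mathrm{EVI}_\lambda(X,d,\phi)$ is a continuous curve $u:(0,+\infty)\to\mathrm{Dom}(\phi)$ with $\frac12\frac{\mathrm d}{\mathrm dt}^{+}d^2(u_t,v)+\frac\lambda2d^2(u_t,v)\le\phi(v)-\phi(u_t)$ for every $t>0$, $v\in\mathrm{Dom}(\phi)$. An $\mathrm{EVI}_\lambda$-gradient flow of $\phi$ in $D\subset\overline{\mathrm{Dom}(\phi)}$ is a family of continuous maps $\mathsf S_t:D\to D$, $t\ge0$, such that for every $u_0\in D$: $\mathsf S_{t+h}(u_0)=\mathsf S_h(\mathsf S_t(u_0))$ for all $t,h\ge0$, $\lim_{t\downarrow0}\mathsf S_t(u_0)=\mathsf S_0(u_0)=u_0$, and $t\mapsto\mathsf S_t(u_0)$ is a solution of $\mathrm{EVI}_\lambda(X,d,\phi)$. *)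

(* Defs.v *)
From HB Require Import structures.
From mathcomp Require Export all_boot all_order all_algebra.
From mathcomp Require Export all_classical all_reals all_analysis.

Set Implicit Arguments.
Unset Strict Implicit.
Unset Printing Implicit Defensive.

Import Order.TTheory GRing.Theory Num.Theory.
Import numFieldNormedType.Exports.

Local Open Scope classical_set_scope.
Local Open Scope ring_scope.

Definition Dom {R : realType} {X : Type} (phi : X -> \bar R) : set X :=
  [set x | (phi x < +oo)%E].

(* A functional into (-oo, +oo] that is not identically +oo. *)
Definition proper_functional {R : realType} {X : Type} (phi : X -> \bar R) :
    Prop :=
  (forall x, (-oo < phi x)%E) /\ Dom phi !=set0.

(* "Isolated" means isolated in X, which is when the limit superior below is
   taken along an improper filter.  A point that is isolated only in Dom phi
   falls under the last case, and gets the value 0 there as well, because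
   (phi x - phi y)^+ = 0 when phi y = +oo. *)
Definition metric_slope {R : realType} {X : metricType R} (phi : X -> \bar R)
    (x : X) : \bar R :=
  if x \notin Dom phi then +oo%E
  else if `[< isolated [set: X] x >] then 0%E
  else limf_esup
         (fun y : X => Order.max (phi x - phi y) 0 * (mdist x y)^-1%:E)%E x^'.

Definition approx_length_subset {R : realType} {X : metricType R}
    (D : set X) : Prop :=
  forall x0 x1, D x0 -> D x1 -> forall eps : R, 0 < eps < 1 ->
  exists2 x, D x &
    mdist x0 x ^+ 2 + mdist x x1 ^+ 2
      <= 2^-1 * mdist x0 x1 ^+ 2 * (1 + eps ^+ 2 / 4).

Record minimizing_movement {R : realType} {X : metricType R}
    (phi : X -> \bar R) (tau eta : R) (U : nat -> X) : Prop := {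
  mm_dom : forall n, Dom phi (U n) ;
  mm_min : forall n V, Dom phi V ->
    (((2 * tau)^-1 * mdist (U n.+1) (U n) ^+ 2)%:E + phi (U n.+1)
     <= ((2 * tau)^-1 * mdist V (U n) ^+ 2)%:E + phi V
        + (eta / 2 * mdist (U n.+1) (U n) * mdist V (U n.+1))%:E)%E ;
  mm_decr : forall n,
    (((2 * tau)^-1 * mdist (U n.+1) (U n) ^+ 2)%:E + phi (U n.+1)
     <= phi (U n))%E }.

(* The least k in nat with t <= k tau, for tau > 0 and t >= 0. *)
Definition step_index {R : realType} (tau t : R) : nat :=
  `|Num.ceil (t / tau)|%N.

Definition interpolant {R : realType} {X : Type} (tau : R) (U : nat -> X)
    (t : R) : X :=
  U (step_index tau t).

Definition step_time {R : realType} (tau t : R) : R :=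
  (step_index tau t)%:R * tau.

Lemma interpolant0 {R : realType} {X : Type} (tau : R) (U : nat -> X) :
  interpolant tau U 0 = U 0%N.
Proof. by rewrite /interpolant /step_index mul0r ceil0. Qed.

Lemma interpolantS {R : realType} {X : Type} (tau : R) (U : nat -> X)
    (n : nat) (t : R) :
  0 < tau -> n%:R * tau < t <= n.+1%:R * tau -> interpolant tau U t = U n.+1.
Proof.
move=> tau0 /andP[nt tn]; rewrite /interpolant /step_index.
rewrite (@ceil_def _ _ n.+1%:Z)//.
have -> : (n.+1%:Z - 1 = n%:Z)%R by rewrite intS [1 + _]addrC addrK.
by rewrite -!pmulrn ltr_pdivlMr// ler_pdivrMr// nt.
Qed.

Lemma step_time_min {R : realType} (tau t : R) : 0 < tau -> 0 <= t ->
  t <= step_time tau t /\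
  forall k : nat, t <= k%:R * tau -> step_time tau t <= k%:R * tau.
Proof.
move=> tau0 t0; rewrite /step_time /step_index.
have c0 : 0 <= Num.ceil (t / tau).
  by rewrite ceil_ge0 (lt_le_trans (ltrN10 R))// divr_ge0// ltW.
rewrite natr_absz (ger0_norm c0) -ler_pdivrMr//; split; first exact: ceil_ge.
by move=> k; rewrite -ler_pdivrMr// ler_pM2r// pmulrn ler_int ceil_le_int.
Qed.

Definition upper_right_derivative {R : realType} (zeta : R -> R) (t : R) :
    \bar R :=
  limf_esup (fun h : R => ((zeta (t + h) - zeta t) / h)%:E) (0 : R)^'+.

(* A curve on (0, +oo) is a total function on R whose values outside
   (0, +oo) are never used. *)
Record EVI_solution {R : realType} {X : metricType R} (lambda : R)
    (phi : X -> \bar R) (u : R -> X) : Prop := {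
  evi_continuous : {within [set t : R | 0 < t], continuous u} ;
  evi_dom : forall t : R, 0 < t -> Dom phi (u t) ;
  evi_ineq : forall (t : R) v, 0 < t -> Dom phi v ->
    (2^-1%:E * upper_right_derivative (fun s => (mdist (u s) v ^+ 2)%R) t
     + (lambda / 2 * mdist (u t) v ^+ 2)%:E
     <= phi v - phi (u t))%E }.

(* S t is likewise only constrained for t >= 0 and on D. *)
Record EVI_flow {R : realType} {X : metricType R} (lambda : R)
    (phi : X -> \bar R) (D : set X) (S : R -> X -> X) : Prop := {
  flow_sub : D `<=` closure (Dom phi) ;
  flow_stable : forall (t : R) u0, 0 <= t -> D u0 -> D (S t u0) ;
  flow_continuous : forall t : R, 0 <= t -> {within D, continuous (S t)} ;
  flow_semigroup : forall (t h : R) u0, 0 <= t -> 0 <= h -> D u0 ->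
    S (t + h) u0 = S h (S t u0) ;
  flow_lim0 : forall u0, D u0 -> S t u0 @[t --> (0 : R)^'+] --> S 0 u0 ;
  flow_init : forall u0, D u0 -> S 0 u0 = u0 ;
  flow_evi : forall u0, D u0 -> EVI_solution lambda phi (fun t => S t u0) }.

(* Main.v *)
Require Import Defs.
From mathcomp Require Import ring lra.
Set Implicit Arguments.
Unset Strict Implicit.
Unset Printing Implicit Defensive.
Import Order.TTheory GRing.Theory Num.Theory.
Import numFieldNormedType.Exports.
Local Open Scope classical_set_scope.
Local Open Scope ring_scope.

(* Put [a := - lambda].  One step of the scheme from [x = U n] to
   [y = U n.+1] is compared with the flow [S t x], [0 <= t <= tau].  Testing
   EVI with [y] bounds [d(S tau x, y) ^ 2 - d(x, y) ^ 2] by the integral of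
   [phi y - phi (S t x)].  Approximate convexity of [phi] along approximate
   geodesics, itself a consequence of EVI, turns the minimality of [y] into
   [phi y <= phi x - d(x, y) ^ 2 / tau] (up to terms in [a], [eta]), while
   [phi (S t x) >= phi x - t s_n ^ 2] with [s_n] a bound for the slope at [U n].
   Since [s_(n+1) := (1 / tau + eta / 2) d(x, y)] bounds the slope at [y], the
   local error satisfies, up to the same terms,
   [d(S tau x, y) ^ 2 <= tau ^ 2 (s_n ^ 2 - s_(n+1) ^ 2)].  These bounds
   telescope: with the contractivity of the flow and Cauchy-Schwarz,
   [N] steps cost at most [sqrt N * tau * exp (gamma N tau) * s_0]. *)

(** * Dini derivatives and Gronwall inequalities *)

(** A bound on the upper right Dini derivative, with the limit superior unfolded and the quotient
    multiplied out so that no extended real occurs. *)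
Definition dini_le {R : realType} (z : R -> R) (t c : R) : Prop :=
  forall e : R, 0 < e ->
  \forall h \near (0 : R)^'+, z (t + h) - z t <= h * (c + e).

Lemma dini_le_mono (R : realType) (z : R -> R) (t c c' : R) :
  c <= c' -> dini_le z t c -> dini_le z t c'.
Proof.
move=> cc dz e /dz dze; near=> h.
have h0 : 0 < h by near: h; exact: nbhs_right_gt.
have /le_trans -> // : z (t + h) - z t <= h * (c + e) by near: h.
by rewrite ler_pM2l// lerD2r.
Unshelve. all: by end_near. Qed.

(** Let [A] be the set of times at which [z] lies below a slightly rising line. Left continuity puts
    [sup A] in [A], and the Dini bound pushes any such supremum short of [b] further to the
    right. *)
Lemma dini_le_nonincreasing (R : realType) (z : R -> R) (a b : R) : a < b ->
  {within `[a, b], continuous z} ->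
  (forall t, a < t < b -> dini_le z t 0) -> z b <= z a.
Proof.
move=> ab /(continuous_within_itvP _ ab)[zin za zb] dz.
apply/ler_addgt0Pr => e e0.
(* The allowance [e] is halved: the offset [e / 2] starts [A] at [a], where only right continuity is
   available, and the slope [k] spends the other half over the whole interval. *)
pose k := e / 2 / (b - a).
have ba0 : 0 < b - a by rewrite subr_gt0.
have k0 : 0 < k by rewrite divr_gt0// divr_gt0.
have ke : k * (b - a) = e / 2 by rewrite /k divfK// gt_eqF.
pose A := [set t | a <= t <= b /\ z t <= z a + e / 2 + k * (t - a)].
have Aa : A a by split; [rewrite lexx ltW|rewrite subrr mulr0 addr0; lra].
have Ab : has_ubound A by exists b => t [/andP[]].
have A0 : A !=set0 by exists a.
have cA := closure_sup A0 Ab.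
have as_ : a < sup A.
  have z1 : z a < z a + e / 2 by lra.
  near a^'+ => t.
  have at_ : a < t by near: t; exact: nbhs_right_gt.
  rewrite (lt_le_trans at_)//; apply: ub_le_sup => //; split.
    by rewrite (ltW at_)/=; near: t; exact: nbhs_right_le.
  have : z t < z a + e / 2 by near: t; exact: cvgr_lt za _ z1.
  have : 0 <= k * (t - a) by rewrite mulr_ge0 ?subr_ge0 ?ltW.
  lra.
have sb : sup A <= b by apply: ge_sup => // t [/andP[]].
set s := sup A in cA as_ sb *.
have zs : z x @[x --> s^'-] --> z s.
  have [<-//|nsb] := eqVneq b s.
  apply: cvg_at_left_filter; apply: zin.
  by rewrite in_itv/= as_ lt_neqAle eq_sym nsb.
have As : A s.
  split; first by rewrite (ltW as_).
  rewrite leNgt; apply/negP => zlt.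
  have nA : \forall x \near s, x < s -> z a + e / 2 + k * (s - a) < z x.
    have := cvgr_gt _ zs _ zlt; rewrite near_withinE; exact.
  have [x [Ax nx]] := cA _ nA.
  have xs : x <= s by exact: ub_le_sup.
  have [_ zx] := Ax.
  have [exs|nxs] := eqVneq x s; first by move: zx zlt; rewrite exs; lra.
  have /nx : x < s by rewrite lt_neqAle nxs.
  have : k * (x - a) <= k * (s - a) by rewrite ler_pM2l// lerD2r.
  lra.
have [_ zsle] := As.
have [bs|nsb] := eqVneq b s; first by move: zsle; rewrite -bs ke; lra.
have {nsb}sb : s < b by rewrite lt_neqAle eq_sym nsb.
have sab : a < s < b by rewrite as_.
have /(_ k k0) dzs := dz _ sab.
have bs0 : 0 < b - s by rewrite subr_gt0.
near (0 : R)^'+ => h.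
have h0 : 0 < h by near: h; exact: nbhs_right_gt.
have hb : h < b - s by near: h; exact: nbhs_right_lt.
have dzh : z (s + h) - z s <= h * (0 + k) by near: h.
have : A (s + h).
  split; first by apply/andP; split; lra.
  move: dzh zsle; rewrite add0r !mulrBr mulrDr (mulrC h); lra.
move=> /(ub_le_sup Ab); rewrite -/s; lra.
Unshelve. all: by end_near. Qed.

(** The increment over a step [h] of the weighted function in [gronwall_affine]. The leftover
    [- a (s + h) (a z + k s)] has a favourable sign; the smallness of [h] against [e] absorbs the
    second-order term that appears when [c] is negative. *)
Lemma gronwall_increment (R : realType) (a c k e h s z z' : R)
    (p := fun s : R => c * (s - a * (s * s) / 2) + k * (s * s) / 2) :
  0 <= a -> 0 <= k -> 0 < e -> 0 < h -> 0 < s -> 0 <= z -> a * (s + h) <= 1 ->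
  `|c| * a * h <= e -> z' - z <= h * (a * z + c + k * s + e / 2) ->
  (1 - a * (s + h)) * z' - p (s + h) - ((1 - a * s) * z - p s) <= h * e.
Proof.
move=> a0 k0 e0 h0 s0 z0 ash ce zz.
have cah : - c * a * h <= e.
  have cc : - c <= `|c| by have := ler_norm (- c); rewrite normrN.
  by rewrite (le_trans _ ce)// !ler_wpM2r// ltW.
have ash0 : 0 <= a * (s + h) by rewrite mulr_ge0// addr_ge0// ltW.
have kh0 : 0 <= k * h by rewrite mulr_ge0// ltW.
have w0 : 0 <= a * z + k * s by rewrite addr_ge0// mulr_ge0// ltW.
pose m := 1 - a * (s + h).
have m0 : 0 <= m by rewrite subr_ge0.
have m1 : 0 <= 1 - m by rewrite /m opprB addrC subrK.
have {}zz := ler_wpM2l m0 zz.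
rewrite [leLHS](_ : _ = m * (z' - z) - a * h * z
    - c * h * (m + a * h / 2) - k * s * h - k * h * h / 2); last first.
  by rewrite /p /m; field.
have := mulr_ge0 m1 w0.
have : 0 <= (1 - m) * (e / 2) by rewrite mulr_ge0 ?divr_ge0// ltW.
have : h * (- (1 - m) * (a * z + k * s) - c * a * h / 2 + m * (e / 2)
    - k * h / 2) <= h * e -> m * (z' - z) - a * h * z
    - c * h * (m + a * h / 2) - k * s * h - k * h * h / 2 <= h * e.
  by move: zz; clear; lra.
move=> reduce e2 w2; apply: reduce; rewrite ler_pM2l//.
by move: cah kh0 e2 w2; clear; lra.
Qed.

(** The forcing [c] serves the integration of EVI; the forcing [k * s] serves the local error, where
    the energy lost up to time [s] is bounded linearly. An affine weight keeps the bound polynomial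
    in [t]. *)
Lemma gronwall_affine (R : realType) (z : R -> R) (a c k t : R) :
  0 <= a -> 0 <= k -> 0 < t -> a * t <= 1 ->
  {within `[0, t], continuous z} ->
  (forall s, 0 < s < t -> 0 <= z s /\ dini_le z s (a * z s + c + k * s)) ->
  (1 - a * t) * z t <= z 0 + c * (t - a * t ^+ 2 / 2) + k * t ^+ 2 / 2.
Proof.
move=> a0 k0 t0 at1 zc dz.
(* The integrating factor [1 - a s] stands for [exp (- a s)]; [p] is the
   integral of [(1 - a s) c + k s]. *)
pose p (s : R) := c * (s - a * (s * s) / 2) + k * (s * s) / 2.
pose g s := (1 - a * s) * z s - p s.
suff : g t <= g 0 by rewrite /g /p !expr2; lra.
apply: dini_le_nonincreasing => //.
  have cX (x : R) : {for x, continuous (fun s : R => s)} by exact: cvg_id.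
  have cp : continuous p.
    move=> x; apply: cvgD; last first.
      apply: cvgM; last exact: cvg_cst.
      by apply: cvgM; [exact: cvg_cst|exact: cvgM].
    apply: cvgM; first exact: cvg_cst.
    apply: cvgB => //; apply: cvgM; last exact: cvg_cst.
    by apply: cvgM; [exact: cvg_cst|exact: cvgM].
  have cq : continuous (fun s : R => 1 - a * s).
    by move=> x; apply: cvgB; [exact: cvg_cst|apply: cvgM; [exact: cvg_cst|]].
  move=> x; apply: cvgB; last exact: (continuous_subspaceT cp).
  by apply: cvgM; [exact: (continuous_subspaceT cq)|exact: zc].
move=> s st e e0; have [zs0 /(_ (e / 2)) dzs] := dz s st.
have {}dzs := dzs ltac:(lra).
have [s0 ts] := andP st.
near=> h.
have h0 : 0 < h by near: h; exact: nbhs_right_gt.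
have ht : h < t - s by near: h; apply: nbhs_right_lt; lra.
have hc : h < e / (`|c| * a + 1).
  by near: h; apply: nbhs_right_lt; rewrite divr_gt0// ltr_wpDl// mulr_ge0.
have zh : z (s + h) - z s <= h * (a * z s + c + k * s + e / 2) by near: h.
move: hc; rewrite ltr_pdivlMr ?ltr_wpDl ?mulr_ge0// => hc.
rewrite add0r; apply: gronwall_increment zh => //.
- by have := ler_wpM2l a0 (ltW ht); lra.
- by rewrite -mulrA mulrC; lra.
Unshelve. all: by end_near. Qed.

(** The exact exponential weight removes any smallness condition on [c * t], as contraction over
    long times requires. *)
Lemma gronwall_exp (R : realType) (z : R -> R) (c t : R) :
  0 <= c -> 0 < t -> {within `[0, t], continuous z} ->
  (forall s, 0 < s < t -> 0 <= z s /\ dini_le z s (c * z s)) ->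
  z t <= expR (c * t) * z 0.
Proof.
move=> c0 t0 zc dz.
pose g s := expR (- (c * s)) * z s.
suff : g t <= g 0.
  rewrite /g mulr0 oppr0 expR0 mul1r => /(ler_wpM2l (expR_ge0 (c * t))).
  by rewrite mulrA -expRD subrr expR0 mul1r.
apply: dini_le_nonincreasing => //.
  have cE : continuous (fun s : R => expR (- (c * s))).
    move=> y; apply: continuous_comp; last exact: continuous_expR.
    by apply: cvgN; apply: cvgM; [exact: cvg_cst|exact: cvg_id].
  by move=> x; apply: cvgM; [exact: (continuous_subspaceT cE)|exact: zc].
move=> s st e e0; have [zs0 /(_ _ e0) dzs] := dz s st.
have [s0 ts] := andP st.
near=> h.
have h0 : 0 < h by near: h; exact: nbhs_right_gt.
have zh : z (s + h) - z s <= h * (c * z s + e) by near: h.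
pose E := expR (- (c * s)); pose F := expR (- (c * h)).
have EF : expR (- (c * (s + h))) = E * F.
  by rewrite -expRD; congr expR; ring.
have E0 : 0 <= E by exact: expR_ge0.
have F0 : 0 <= F by exact: expR_ge0.
have E1 : E <= 1 by rewrite -expR0 ler_expR oppr_le0 mulr_ge0// ltW.
have F1 : F <= 1 by rewrite -expR0 ler_expR oppr_le0 mulr_ge0// ltW.
(* The bound [exp (c h) >= 1 + c h] stands in for the derivative of the weight. *)
have FF : F * (1 + c * h) <= 1.
  rewrite (le_trans (ler_wpM2l F0 (expR_ge1Dx _)))//.
  by rewrite -expRD addrC subrr expR0.
rewrite /g EF add0r.
have EF0 : 0 <= E * F by rewrite mulr_ge0.
have := ler_wpM2l EF0 zh.
have := ler_wpM2l (mulr_ge0 E0 zs0) FF.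
have EF1 : E * F <= 1 by rewrite -[1]mulr1 ler_pM.
have := ler_wpM2r (mulr_ge0 (ltW h0) (ltW e0)) EF1.
by rewrite -/E; lra.
Unshelve. all: by end_near. Qed.

(** * Semigroups satisfying EVI *)

Lemma mdist_cvg (R : realType) (X : metricType R) (T : Type)
    (F : set_system T) (FF : Filter F) (u v : T -> X) (x y : X) :
  u @ F --> x -> v @ F --> y -> mdist (u s) (v s) @[s --> F] --> mdist x y.
Proof.
move=> ux vy; apply/cvgrPdist_lt => e e0.
have e20 : 0 < e / 2 by rewrite divr_gt0.
near=> s.
have us : mdist x (u s) < e / 2.
  by near: s; exact: (metricType_numDomainType.cvgr_dist_lt ux e20).
have vs : mdist y (v s) < e / 2.
  by near: s; exact: (metricType_numDomainType.cvgr_dist_lt vy e20).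
have h1 := metric_triangle x (u s) y.
have h2 := metric_triangle (u s) (v s) y.
have h3 := metric_triangle (u s) x (v s).
have h4 := metric_triangle x y (v s).
rewrite (metric_sym (v s) y) (metric_sym (u s) x) in h2 h3 *.
by rewrite ltr_distl; apply/andP; split; lra.
Unshelve. all: by end_near. Qed.

Lemma sqr_mdist_cvg (R : realType) (X : metricType R) (T : Type)
    (F : set_system T) (FF : Filter F) (u v : T -> X) (x y : X) :
  u @ F --> x -> v @ F --> y ->
  mdist (u s) (v s) ^+ 2 / 2 @[s --> F] --> mdist x y ^+ 2 / 2.
Proof.
move=> ux vy; apply: cvgM; last exact: cvg_cst.
by rewrite expr2; apply: cvgM; exact: mdist_cvg.
Qed.

(** The first EVI bound times [1 - a h], added to the second, eliminates the mixed term [q]. The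
    values [fv] cancel up to a factor [a h], leaving the small drop [fx - fu]; the factor
    [(1 - a h)^2] in front of [z'] produces the rate [2 a]. *)
Lemma contraction_increment (R : realType) (a h e z z' q fx fu fv : R) :
  0 <= a -> 0 < h -> 0 < e -> 0 <= z' -> a * h <= 1 ->
  (1 - a * h) * z' - q <= (fv - fu) * (h - a * h ^+ 2 / 2) ->
  (1 - a * h) * q - z <= (fx - fv) * (h - a * h ^+ 2 / 2) ->
  fx - fu <= e / 4 -> a * h * (fu - fv) <= e / 4 ->
  z' <= z + e / (8 * a + 8) ->
  z' - z <= h * (2 * a * z + e).
Proof.
set J := h - _ => a0 h0 e0 z0 ah1 E1 E2 fxu fuv zz.
have ah0 : 0 <= a * h by rewrite mulr_ge0// ltW.
have JE : J = h * (1 - a * h / 2) by rewrite /J; ring.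
have J0 : 0 <= J by rewrite JE mulr_ge0 ?(ltW h0)//; lra.
have Jh : J <= h by rewrite JE ger_pMr//; lra.
have {}E1 : (1 - a * h) * ((1 - a * h) * z' - q)
    <= (1 - a * h) * ((fv - fu) * J).
  by rewrite ler_wpM2l//; lra.
have JK : J * (fx - fu + a * h * (fu - fv)) <= h * (e / 2).
  rewrite (@le_trans _ _ (J * (e / 2)))//; first by rewrite ler_wpM2l//; lra.
  by rewrite ler_wpM2r//; lra.
have ahz : a * h * z' <= a * h * (z + e / (8 * a + 8)) by rewrite ler_wpM2l.
have ahe : a * h * (e / (8 * a + 8)) <= h * (e / 8).
  rewrite (mulrC a) -mulrA ler_pM2l// mulrA ler_pdivrMr; last by lra.
  by rewrite mulrC; lra.
have ahz2 : 0 <= (a * h) ^+ 2 * z' by rewrite mulr_ge0// sqr_ge0.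
have he0 : 0 <= h * e by rewrite mulr_ge0// ltW.
clear J0 Jh ah0 ah1 a0 h0 e0 z0 fxu fuv zz JE; clearbody J.
lra.
Qed.

(* [a] stands for [- lambda] and [f] for the finite part of the functional,
   which is a junk value outside of its domain [D]. *)
Record evi_semigroup {R : realType} {X : metricType R} (a : R) (D : set X)
    (f : X -> R) (S : R -> X -> X) : Prop := {
  sg_dom : forall (t : R) x, 0 < t -> closure D x -> D (S t x) ;
  sg_cvg : forall (t : R) x, 0 < t -> closure D x -> S s x @[s --> t] --> S t x ;
  sg_cvg0 : forall x, closure D x -> S s x @[s --> (0 : R)^'+] --> x ;
  sg_semigroup : forall (t h : R) x, 0 <= t -> 0 <= h -> closure D x ->
    S (t + h) x = S h (S t x) ;
  sg_init : forall x, closure D x -> S 0 x = x ;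
  sg_lsc : forall x (e : R), D x -> 0 < e ->
    \forall y \near x, D y -> f x - e < f y ;
  sg_evi : forall x v (t : R), 0 < t -> closure D x -> D v ->
    dini_le (fun s => mdist (S s x) v ^+ 2 / 2) t
      (a * (mdist (S t x) v ^+ 2 / 2) + (f v - f (S t x))) }.

Section evi_semigroup_theory.
Context {R : realType} {X : metricType R}.
Variables (a : R) (D : set X) (f : X -> R) (S : R -> X -> X).
Hypotheses (a0 : 0 <= a) (HS : evi_semigroup a D f S).

Lemma sg_closure (t : R) x : 0 <= t -> closure D x -> closure D (S t x).
Proof.
rewrite le_eqVlt => /orP[/eqP <- cx|t0 cx].
  by rewrite (sg_init HS).
by apply: subset_closure; exact: (sg_dom HS).
Qed.

Lemma sg_dom0 (t : R) x : 0 <= t -> D x -> D (S t x).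
Proof.
move=> + Dx; have cx : closure D x by exact: subset_closure.
rewrite le_eqVlt => /orP[/eqP <-|t0]; first by rewrite (sg_init HS).
exact: (sg_dom HS).
Qed.

Lemma sg_within_mdist (x y : X) (t : R) : 0 < t -> closure D x -> closure D y ->
  {within `[0, t], continuous (fun s => mdist (S s x) (S s y) ^+ 2 / 2)}.
Proof.
move=> t0 cx cy.
apply/(continuous_within_itvP _ t0); split.
- move=> s; rewrite in_itv/= => /andP[s0 _].
  by apply: sqr_mdist_cvg; exact: (sg_cvg HS).
- by rewrite !(sg_init HS)//; apply: sqr_mdist_cvg; exact: (sg_cvg0 HS).
- by apply: sqr_mdist_cvg; apply: cvg_at_left_filter; exact: (sg_cvg HS).
Qed.

Lemma sg_within_mdistl (x v : X) (t : R) : 0 < t -> closure D x ->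
  {within `[0, t], continuous (fun s => mdist (S s x) v ^+ 2 / 2)}.
Proof.
move=> t0 cx.
apply/(continuous_within_itvP _ t0); split.
- move=> s; rewrite in_itv/= => /andP[s0 _].
  by apply: sqr_mdist_cvg; [exact: (sg_cvg HS)|exact: cvg_cst].
- rewrite !(sg_init HS)//.
  by apply: sqr_mdist_cvg; [exact: (sg_cvg0 HS)|exact: cvg_cst].
- apply: sqr_mdist_cvg; last exact: cvg_cst.
  by apply: cvg_at_left_filter; exact: (sg_cvg HS).
Qed.

(** By lower semicontinuity, the supremum [s] of the times with energy at most [f x] is attained. If
    [s < t], EVI from [y = S s x] tested with [y] itself has a negative energy term, so Gronwall
    from distance zero freezes the flow at [y], although the energy was to exceed [f x]
    afterwards. *)
Lemma sg_nonincreasing (t : R) x : 0 <= t -> D x -> f (S t x) <= f x.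
Proof.
move=> t0 Dx.
have cx : closure D x by exact: subset_closure.
pose A := [set s | 0 <= s <= t /\ f (S s x) <= f x].
have Aa : A 0 by rewrite /A/= lexx t0 (sg_init HS).
have Ab : has_ubound A by exists t => s [/andP[]].
have A0 : A !=set0 by exists 0.
have cA := closure_sup A0 Ab.
have s0 : 0 <= sup A by exact: ub_le_sup.
have st : sup A <= t by apply: ge_sup => // s [/andP[]].
set s := sup A in cA s0 st *.
have fs : f (S s x) <= f x.
  move: s0; rewrite le_eqVlt => /orP[/eqP <-|s0]; first by rewrite (sg_init HS).
  apply/ler_addgt0Pr => e e0.
  have Dsx : D (S s x) by exact: (sg_dom HS).
  have := sg_lsc HS Dsx e0 => /(sg_cvg HS s0 cx) near_s.
  have [r [[/andP[r0 rt] fr] lr]] := cA _ near_s.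
  by have := lr (sg_dom0 r0 Dx); move: fr; lra.
have [<-//|nst] := eqVneq s t.
have {nst}st : s < t by rewrite lt_neqAle nst.
pose y := S s x.
have Dy : D y by exact: sg_dom0.
have cy : closure D y by exact: subset_closure.
have fy r : 0 < r <= t - s -> f x < f (S r y).
  move=> /andP[r0 rts]; rewrite ltNge; apply/negP => fr.
  have : A (s + r).
    split; first by apply/andP; split; lra.
    by rewrite (sg_semigroup HS)// ltW.
  by move=> /(ub_le_sup Ab); rewrite -/s; lra.
have ts0 : 0 < t - s by rewrite subr_gt0.
have := @gronwall_exp R (fun r => mdist (S r y) y ^+ 2 / 2) a (t - s) a0 ts0
  (sg_within_mdistl ts0 cy).
rewrite (sg_init HS)// mdistxx expr0n/= mul0r mulr0 => dist0.
have : mdist (S (t - s) y) y ^+ 2 / 2 <= 0.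
  apply: dist0 => r /andP[r0 rts]; split; first by rewrite divr_ge0// sqr_ge0.
  apply: dini_le_mono (sg_evi HS r0 cy Dy).
  have : f x < f (S r y) by apply: fy; rewrite r0 ltW.
  by move: fs; rewrite -/y; lra.
rewrite pmulr_lle0 ?invr_gt0// => dist_le0.
have /mdist_positivity Sy : mdist (S (t - s) y) y = 0.
  by apply/eqP; rewrite -sqrf_eq0 eq_le dist_le0 sqr_ge0.
have : f x < f (S (t - s) y) by apply: fy; rewrite ts0 lexx.
by rewrite Sy; move: fs; rewrite -/y; lra.
Qed.

Lemma sg_monotone (s t : R) x : 0 < s <= t -> closure D x ->
  f (S t x) <= f (S s x).
Proof.
move=> /andP[s0 st] cx.
have -> : S t x = S (t - s) (S s x).
  by rewrite -(sg_semigroup HS) ?subr_ge0//; [congr S; lra|exact: ltW].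
by apply: sg_nonincreasing; [rewrite subr_ge0|exact: (sg_dom HS)].
Qed.

(** Since the energy decreases along the flow, [f v - f (S s x)] is at most its value at the final
    time, so [gronwall_affine] applies with constant forcing. *)
Lemma sg_evi_integral (t : R) x v : 0 < t -> a * t <= 1 -> closure D x -> D v ->
  (1 - a * t) * (mdist (S t x) v ^+ 2 / 2) - mdist x v ^+ 2 / 2
    <= (f v - f (S t x)) * (t - a * t ^+ 2 / 2).
Proof.
move=> t0 at1 cx Dv.
have := @gronwall_affine R (fun s => mdist (S s x) v ^+ 2 / 2) a
  (f v - f (S t x)) 0 t a0 (lexx _) t0 at1 (sg_within_mdistl t0 cx).
rewrite (sg_init HS)// !mul0r addr0 => gron.
rewrite lerBlDl; apply: gron => s /andP[s0 st].
split; first by rewrite divr_ge0// sqr_ge0.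
apply: dini_le_mono (sg_evi HS s0 cx Dv).
have : f (S t x) <= f (S s x) by apply: sg_monotone => //; rewrite s0 ltW.
by rewrite mul0r; lra.
Qed.

(* EVI from [S t x], tested with [S (t + h) y], and EVI from [S t y], tested
   with [S t x], bound the increment of the squared distance. *)
Lemma sg_contraction (t : R) x y : 0 <= t -> closure D x -> closure D y ->
  mdist (S t x) (S t y) <= expR (a * t) * mdist x y.
Proof.
move=> + cx cy.
rewrite le_eqVlt => /orP[/eqP <-|t0].
  by rewrite !(sg_init HS)// mulr0 expR0 mul1r.
have a20 : 0 <= 2 * a by rewrite mulr_ge0.
have /= := @gronwall_exp R (fun s => mdist (S s x) (S s y) ^+ 2 / 2) (2 * a) t
  a20 t0 (sg_within_mdist t0 cx cy).
rewrite !(sg_init HS)// => gron.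
suff H : mdist (S t x) (S t y) ^+ 2 / 2
    <= expR (2 * a * t) * (mdist x y ^+ 2 / 2).
  rewrite -ler_sqr ?nnegrE ?mdist_ge0 ?mulr_ge0 ?expR_ge0 ?mdist_ge0//.
  rewrite exprMn -expRM_natl; move: H.
  by rewrite (_ : 2%:R * (a * t) = 2 * a * t)//; [lra|ring].
apply: gron => {t t0} t /andP[t0 _].
split; first by rewrite divr_ge0// sqr_ge0.
have Dx : D (S t x) by exact: (sg_dom HS).
have Dy : D (S t y) by exact: (sg_dom HS).
have cSx : closure D (S t x) by exact: subset_closure.
have cSy : closure D (S t y) by exact: subset_closure.
pose z s := mdist (S s x) (S s y) ^+ 2 / 2.
move=> e e0.
pose u h := S h (S t x); pose v h := S h (S t y).
have ucvg : u h @[h --> (0 : R)^'+] --> S t x by exact: (sg_cvg0 HS).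
have vcvg : v h @[h --> (0 : R)^'+] --> S t y by exact: (sg_cvg0 HS).
have zE h : 0 < h -> z (t + h) = mdist (u h) (v h) ^+ 2 / 2.
  by move=> h0; rewrite /z !(sg_semigroup HS) // ltW.
(* For small [h], [M] bounds [f (u h) - f (v h)], which makes the uncancelled term
   [a h (f (u h) - f (v h))] negligible. *)
pose M := `|f (S t x) - f (S t y)| + 1.
have M0 : 0 < M by rewrite /M ltr_wpDl.
have Ma0 : 0 < M * a + 1 by rewrite ltr_wpDl// mulr_ge0// ltW.
have e40 : 0 < e / 4 by lra.
have a80 : 0 < e / (8 * a + 8) by rewrite divr_gt0//; lra.
have zcvg : mdist (u h) (v h) ^+ 2 / 2 @[h --> (0 : R)^'+] --> z t.
  exact: sqr_mdist_cvg.
have zlt : z t < z t + e / (8 * a + 8) by rewrite ltrDl.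
have nfu := ucvg _ (sg_lsc HS Dx e40).
have nfv := vcvg _ (sg_lsc HS Dy ltr01).
near=> h.
have h0 : 0 < h by near: h; exact: nbhs_right_gt.
have zh : z (t + h) < z t + e / (8 * a + 8).
  by rewrite zE//; near: h; exact: (cvgr_lt _ zcvg).
have hM : h < e / 4 / (M * a + 1).
  by near: h; apply: nbhs_right_lt; rewrite divr_gt0.
have ha : h < (a + 1)^-1 by near: h; apply: nbhs_right_lt; rewrite invr_gt0; lra.
have fu : D (u h) -> f (S t x) - e / 4 < f (u h).
  by near: h; exact: nfu.
have fv : D (v h) -> f (S t y) - 1 < f (v h).
  by near: h; exact: nfv.
have Du : D (u h) by apply: sg_dom0 => //; exact: ltW.
have Dv : D (v h) by apply: sg_dom0 => //; exact: ltW.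
have {}fu := fu Du; have {}fv := fv Dv.
have fu' : f (u h) <= f (S t x) by apply: sg_nonincreasing => //; exact: ltW.
move: hM; rewrite ltr_pdivlMr// => hM.
move: ha; rewrite -div1r ltr_pdivlMr; last by lra.
move=> ha.
have ah0 : 0 <= a * h by rewrite mulr_ge0// ltW.
have ah1 : a * h <= 1 by lra.
have := sg_evi_integral h0 ah1 cSx Dv.
have := sg_evi_integral h0 ah1 cSy Dx.
rewrite -/(u h) -/(v h) (metric_sym (v h)) (metric_sym (S t y)) -/(z t) -zE//.
move=> E2 E1; rewrite -/(z (t + h)) -/(z t).
apply: (contraction_increment a0 h0 e0 _ ah1 E1 E2) (ltW zh) => //.
- by rewrite divr_ge0// sqr_ge0.
- by lra.
have fuv : f (u h) - f (v h) <= M.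
  by have := ler_norm (f (S t x) - f (S t y)); rewrite /M; lra.
by have := ler_wpM2l ah0 fuv; lra.
Unshelve. all: by end_near. Qed.

End evi_semigroup_theory.

(** * Slope and speed *)

(** A bound [s] on the metric slope within [D]. Without a quotient, [y = x] need not be excluded,
    and an isolated point satisfies it for every [s]. *)
Definition slope_le {R : realType} {X : metricType R} (D : set X) (f : X -> R)
    (x : X) (s : R) : Prop :=
  forall e : R, 0 < e ->
  \forall y \near x, D y -> f x - f y <= (s + e) * mdist x y.

Lemma near_right0_lt (R : realType) (P : R -> Prop) :
  (\forall h \near (0 : R)^'+, P h) ->
  exists2 d : R, 0 < d & forall h, 0 < h < d -> P h.
Proof.
case=> d /= d0 H; exists d => // h /andP[h0 hd].
by apply: H => //=; rewrite sub0r normrN gtr0_norm.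
Qed.

Section slope.
Context {R : realType} {X : metricType R}.
Variables (a : R) (D : set X) (f : X -> R) (S : R -> X -> X).
Hypotheses (a_ge0 : 0 <= a) (HS : evi_semigroup a D f S).
Variables (x : X) (s : R).
Hypotheses (Dx : D x) (s_ge0 : 0 <= s) (xs : slope_le D f x s).

Let cx : closure D x. Proof. exact: subset_closure. Qed.

Let ucvg : S h x @[h --> (0 : R)^'+] --> x. Proof. exact: (sg_cvg0 HS). Qed.

(** EVI tested with [x] bounds the squared distance by [t] times the energy drop, which tends to
    zero by lower semicontinuity. This supplies the initial value in the sharper bound that
    follows. *)
Lemma sg_sqr_speed_cvg0 (e : R) : 0 < e ->
  \forall t \near (0 : R)^'+, mdist (S t x) x ^+ 2 / 2 <= e * t.
Proof.
move=> e0; have a0 := a_ge0; have s0 := s_ge0.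
have e20 : 0 < e / 2 by lra.
have nf := ucvg (sg_lsc HS Dx e20).
near=> t.
have t0 : 0 < t by near: t; exact: nbhs_right_gt.
have ta : t < (2 * a + 1)^-1.
  by near: t; apply: nbhs_right_lt; rewrite invr_gt0; lra.
have ft : D (S t x) -> f x - e / 2 < f (S t x) by near: t; exact: nf.
have {}ft := ft (sg_dom HS t0 cx).
move: ta; rewrite -div1r ltr_pdivlMr; last by lra.
move=> ta.
have at0 : 0 <= a * t by rewrite mulr_ge0// ltW.
have at1 : a * t <= 1 by lra.
have := sg_evi_integral a0 HS t0 at1 cx Dx.
rewrite mdistxx expr0n/= mul0r subr0.
set z := _ / 2; set J := t - _ => zJ.
have z0 : 0 <= z by rewrite divr_ge0// sqr_ge0.
have att0 : 0 <= a * t * t by rewrite mulr_ge0// ltW.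
have J0 : 0 <= J.
  by have : a * t * t <= t; [rewrite ger_pMl|rewrite /J expr2; lra].
have Jt : J <= t by rewrite /J expr2; lra.
have : (f x - f (S t x)) * J <= e / 2 * t.
  have fe : f x - f (S t x) <= e / 2 by lra.
  rewrite (le_trans (ler_wpM2r J0 fe))// ler_wpM2l//; lra.
have : z / 2 <= (1 - a * t) * z by rewrite mulrC ler_wpM2r//; lra.
lra.
Unshelve. all: by end_near. Qed.

(** Near [x] the slope controls the energy drop, so EVI tested with [x] bounds the derivative of
    half the squared distance by [s + e] times the distance. *)
Lemma sg_speed_near0 (e : R) : 0 < e ->
  \forall t \near (0 : R)^'+, mdist (S t x) x <= (s + e) * t.
Proof.
move=> e0; have a0 := a_ge0; have s0 := s_ge0.
have e20 : 0 < e / 2 by lra.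
have nf : \forall h \near (0 : R)^'+, D (S h x) ->
    f x - f (S h x) <= (s + e / 2) * mdist x (S h x) by exact: (ucvg (xs e20)).
(* Once [a d <= e], the term [a d^2 / 2] of EVI raises the slope by at most [e / 2]. *)
have nd : \forall h \near (0 : R)^'+, a * mdist x (S h x) <= e.
  have ea : 0 < e / (a + 1) by rewrite divr_gt0//; lra.
  near=> h; have : mdist x (S h x) < e / (a + 1).
    by near: h; exact: (metricType_numDomainType.cvgr_dist_lt ucvg ea).
  rewrite ltr_pdivlMr; last by lra.
  by have := mdist_ge0 x (S h x); lra.
have [d d0 H] := near_right0_lt (filterI nf nd).
near=> t.
have t0 : 0 < t by near: t; exact: nbhs_right_gt.
have td : t < d by near: t; exact: nbhs_right_lt.
pose L := s + e.
have L0 : 0 < L by rewrite /L; lra.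
pose z r := mdist (S r x) x ^+ 2 / 2.
(* AM-GM makes the Dini derivative of [z r / r] at most [L ^+ 2 / 2], so that
   the sharp constant [L] is obtained without dividing by [mdist (S r x) x],
   which may vanish. *)
pose g r := z r / r - L ^+ 2 / 2 * r.
have z0 r : 0 <= z r by rewrite divr_ge0// sqr_ge0.
have gt_le (r : R) : 0 < r < t -> g t <= g r.
  move=> /andP[r0 rt]; apply: dini_le_nonincreasing => //.
    apply: continuous_in_subspaceT => q; rewrite inE/= in_itv/= => /andP[rq _].
    have q0 : 0 < q by exact: lt_le_trans rq.
    apply: cvgB; last by apply: cvgM; [exact: cvg_cst|exact: cvg_id].
    apply: cvgM; last by apply: cvgV; [rewrite gt_eqF|exact: cvg_id].
    by apply: sqr_mdist_cvg; [exact: (sg_cvg HS)|exact: cvg_cst].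
  move=> q /andP[rq qt]; have q0 : 0 < q by exact: lt_trans rq.
  have [Hf Hd] := H q ltac:(by rewrite q0/= (lt_trans qt)).
  have {}Hf := Hf (sg_dom HS q0 cx).
  rewrite metric_sym in Hf Hd.
  pose dq := mdist (S q x) x.
  have dq0 : 0 <= dq by exact: mdist_ge0.
  move=> k k0; have kq0 : 0 < k * q by rewrite mulr_gt0.
  have dz : dini_le z q (L * dq).
    apply: dini_le_mono (sg_evi HS q0 cx Dx).
    have := ler_wpM2r dq0 Hd.
    by move: Hf; rewrite /L -/dq expr2; lra.
  have {}dz := dz _ kq0.
  near=> h.
  have h0 : 0 < h by near: h; exact: nbhs_right_gt.
  have zh : z (q + h) - z q <= h * (L * dq + k * q) by near: h.
  have qh0 : 0 < q + h by rewrite addr_gt0.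
  pose w := z q / q.
  have zw : z q = w * q by rewrite /w divfK// gt_eqF.
  have amgm : L * dq <= w + L ^+ 2 / 2 * q.
    rewrite -(ler_pM2r q0).
    have := sqr_ge0 (L * q - dq).
    have : dq ^+ 2 = 2 * (w * q) by rewrite -zw /z -/dq; field.
    by rewrite !expr2; lra.
  suff : z (q + h) / (q + h) <= w + h * (L ^+ 2 / 2 + k) by rewrite /g -/w; lra.
  rewrite ler_pdivrMr//.
  have := ler_wpM2l (ltW h0) amgm.
  have : 0 <= h * h * (L ^+ 2 / 2 + k).
    by rewrite mulr_ge0 ?mulr_ge0 ?addr_ge0 ?divr_ge0 ?sqr_ge0// ltW.
  by move: zh; rewrite zw; lra.
have gt0 : g t <= 0.
  apply/ler_addgt0Pr => k k0; rewrite add0r.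
  near (0 : R)^'+ => r.
  have r0 : 0 < r by near: r; exact: nbhs_right_gt.
  have rt : r < t by near: r; exact: nbhs_right_lt.
  have zr : z r <= k * r by near: r; exact: sg_sqr_speed_cvg0.
  have /le_trans -> // : g t <= g r by apply: gt_le; rewrite r0.
  have : z r / r <= k by rewrite ler_pdivrMr.
  have : 0 <= L ^+ 2 / 2 * r by rewrite mulr_ge0 ?divr_ge0 ?sqr_ge0// ltW.
  by rewrite /g; lra.
rewrite -/L -ler_sqr ?nnegrE ?mdist_ge0 ?mulr_ge0 ?(ltW L0) ?(ltW t0)//.
move: gt0; rewrite /g subr_le0 ler_pdivrMr// /z exprMn (expr2 t); lra.
Unshelve. all: by end_near. Qed.

(** The time [t] is cut into [N] equal short steps. Contractivity transports the displacement of the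
    first step along the flow, at the price of a factor at most [exp (a t)] per step. *)
Lemma sg_speed (t : R) : 0 <= t -> mdist (S t x) x <= t * expR (a * t) * s.
Proof.
have a0 := a_ge0; have s0 := s_ge0.
rewrite le_eqVlt => /orP[/eqP <-|t0].
  by rewrite (sg_init HS)// mdistxx !mul0r.
apply/ler_addgt0Pr => e e0.
(* A slack [e / E] in the slope costs exactly [e] at time [t]. *)
pose E := t * expR (a * t).
have E0 : 0 < E by rewrite mulr_gt0// expR_gt0.
have eE0 : 0 < e / E by rewrite divr_gt0.
have [d d0 H] := near_right0_lt (sg_speed_near0 eE0).
pose N := (Num.truncn (t / d)).+1.
have N0 : (0 : R) < N%:R by rewrite ltr0n.
pose h := t / N%:R.
have h0 : 0 < h by rewrite divr_gt0.
have hd : h < d.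
  by rewrite /h ltr_pdivrMr// mulrC -ltr_pdivrMr// /N truncnS_gt.
have Sh : mdist (S h x) x <= (s + e / E) * h by apply: H; rewrite h0.
have step n : mdist (S (n%:R * h) x) x
    <= n%:R * expR (a * (n%:R * h)) * ((s + e / E) * h).
  elim: n => [|n IHn]; first by rewrite !mul0r (sg_init HS)// mdistxx.
  have nh0 : 0 <= n%:R * h by rewrite mulr_ge0// ltW.
  have -> : n.+1%:R * h = h + n%:R * h by rewrite -natr1 mulrDl mul1r addrC.
  rewrite (sg_semigroup HS)//; last exact: ltW.
  rewrite (le_trans (metric_triangle _ (S (n%:R * h) x) _))//.
  have cSh : closure D (S h x) by apply: (sg_closure HS) => //; exact: ltW.
  have := sg_contraction a0 HS nh0 cSh cx.
  have := ler_wpM2l (expR_ge0 (a * (n%:R * h))) Sh.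
  have K0 : 0 <= (s + e / E) * h.
    by rewrite mulr_ge0 ?addr_ge0// ltW.
  have : expR (a * (n%:R * h)) <= expR (a * (h + n%:R * h)).
    by rewrite ler_expR ler_wpM2l// lerDr ltW.
  have n0 : (0 : R) <= n.+1%:R by [].
  move=> /(ler_wpM2l n0)/(ler_wpM2r K0).
  rewrite -natr1; lra.
have Nh : N%:R * h = t by rewrite /h mulrC divfK// gt_eqF.
have := step N; rewrite Nh => /le_trans; apply.
rewrite (_ : N%:R * expR (a * t) * ((s + e / E) * h)
  = (N%:R * h) * expR (a * t) * (s + e / E)); last by ring.
by rewrite Nh -/E mulrDr (mulrC E (e / E)) divfK// gt_eqF.
Qed.

(** EVI integrated from [x] and tested with [y] is divided by [t], with [t] tending to zero: as the
    initial speed is at most [s], the squared distance to [y] drops by at most about [2 d s t]. *)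
Lemma slope_le_global (y : X) : D y ->
  f x - f y <= s * mdist x y + a / 2 * mdist x y ^+ 2.
Proof.
move=> Dy; have a0 := a_ge0; have s0 := s_ge0; set d := mdist x y.
have dd0 : 0 <= d by exact: mdist_ge0.
apply/ler_addgt0Pr => e e0.
(* The slack [k] is spent once on semicontinuity, [d] times on the speed, and less than once on the
   second-order term [a t F / 2]. *)
pose k := e / (d + 2).
have d20 : 0 < d + 2 by lra.
have k0 : 0 < k by rewrite divr_gt0.
have ke : k * (d + 2) = e by rewrite /k divfK// gt_eqF.
have nf := ucvg (sg_lsc HS Dx k0).
pose F := f x - k - f y.
near (0 : R)^'+ => t.
have t0 : 0 < t by near: t; exact: nbhs_right_gt.
have ta : t < (a + 1)^-1 by near: t; apply: nbhs_right_lt; rewrite invr_gt0; lra.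
have tF : t < k / (`|F| * a + 1).
  by near: t; apply: nbhs_right_lt; rewrite divr_gt0// ltr_wpDl// mulr_ge0.
have ft : D (S t x) -> f x - k < f (S t x) by near: t; exact: nf.
have {}ft := ft (sg_dom HS t0 cx).
have rt : mdist (S t x) x <= (s + k) * t by near: t; exact: sg_speed_near0.
move: ta; rewrite -div1r ltr_pdivlMr; last by lra.
move=> ta.
move: tF; rewrite ltr_pdivlMr ?ltr_wpDl ?mulr_ge0// => tF.
have at0 : 0 <= a * t by rewrite mulr_ge0// ltW.
have at1 : a * t <= 1 by lra.
have := sg_evi_integral a0 HS t0 at1 cx Dy.
rewrite -/d.
set q := mdist (S t x) y; have q0 : 0 <= q by exact: mdist_ge0.
have tri : d <= mdist (S t x) x + q.
  by rewrite (metric_sym (S t x)) /d metric_triangle.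
have qd : d ^+ 2 - 2 * d * ((s + k) * t) <= q ^+ 2.
  (* If the flow may have moved by [d] or more, the left side is nonpositive; otherwise the triangle
     inequality can be squared. *)
  have [dle|dgt] := leP d ((s + k) * t).
    have := ler_wpM2l dd0 dle.
    have := sqr_ge0 q; have := sqr_ge0 d.
    by rewrite !expr2; lra.
  have d1 : d - (s + k) * t <= q by lra.
  have : (d - (s + k) * t) ^+ 2 <= q ^+ 2.
    by rewrite ler_sqr ?nnegrE// subr_ge0 ltW.
  by have := sqr_ge0 ((s + k) * t); rewrite !expr2; lra.
have J0 : 0 < 1 - a * t / 2 by lra.
move=> Eq.
have {}Eq : F * (1 - a * t / 2) <= a * d ^+ 2 / 2 + d * (s + k).
  rewrite -(ler_pM2r t0).
  have : F * ((1 - a * t / 2) * t) <= (f (S t x) - f y) * ((1 - a * t / 2) * t).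
    by rewrite ler_wpM2r ?mulr_ge0 ?(ltW t0) ?(ltW J0)// /F; lra.
  have m0 : 0 <= 1 - a * t by lra.
  have := ler_wpM2l m0 qd.
  have : 0 <= a * t * (d * (s + k) * t).
    by rewrite !mulr_ge0 ?addr_ge0// ltW.
  move: Eq; rewrite !expr2; lra.
have : F * (a * t) <= `|F| * (a * t) by rewrite ler_wpM2r// ler_norm.
by have := ke; move: Eq; rewrite /F; lra.
Unshelve. all: by end_near. Qed.

End slope.

(** * Approximate convexity *)

(** By the parallelogram identity, the bound on [m^2 + n^2] caps [m + n] just above [d]; since
    [m + n >= d], it also makes [m - n] small. *)
Lemma approx_midpoint_le (R : realType) (d m n t : R) :
  0 <= d -> 0 <= m -> 0 <= n -> 0 < t -> d <= m + n ->
  m ^+ 2 + n ^+ 2 <= 2^-1 * d ^+ 2 * (1 + t ^+ 2 / 4) ->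
  m <= d / 2 * (1 + t).
Proof.
move=> d0 m0 n0 t0 dmn mn.
have mn_sum : m + n <= d * (1 + t / 2).
  rewrite -ler_sqr ?nnegrE ?addr_ge0 ?mulr_ge0//; last by lra.
  have := sqr_ge0 (m - n).
  have : 0 <= d ^+ 2 * t by rewrite mulr_ge0 ?sqr_ge0// ltW.
  by move: mn; rewrite !expr2; lra.
have mn_diff : m - n <= d * (t / 2).
  have dt0 : 0 <= d * (t / 2) by rewrite mulr_ge0//; lra.
  rewrite (le_trans (ler_norm _))// -ler_sqr ?nnegrE// real_normK ?num_real//.
  have : d ^+ 2 <= (m + n) ^+ 2 by rewrite ler_sqr ?nnegrE ?addr_ge0.
  by move: mn; rewrite !expr2; lra.
lra.
Qed.

(** Here [m] and [q] are the distances to a fixed point before and after flowing for time [t]. EVI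
    and the quadratic lower bound give [q^2 (1 - K t) <= m^2 + t C], which is incompatible with
    [q > Q] because [Q^2 >= d^2 / 4 + e^2]. *)
Lemma midpoint_drift_le (R : realType) (a A B d e t m q fx p : R)
    (K := a + 2 * B) (Q := d / 2 + e) (C := 2 * `|fx - A|) :
  0 <= a -> 0 <= B -> 0 <= d -> 0 < e -> 0 < t -> t < 1 ->
  t * (K + 1) < 1 -> t * (K * Q ^+ 2 + 3 * d ^+ 2 / 4 + C + 1) < e ^+ 2 ->
  0 <= m -> 0 <= q -> m <= d / 2 * (1 + t) -> A - B * q ^+ 2 <= p ->
  (1 - a * t) * (q ^+ 2 / 2) - m ^+ 2 / 2 <= (fx - p) * (t - a * t ^+ 2 / 2) ->
  q <= Q.
Proof.
move=> a0 B0 d0 e0 t0 t1 tK tM m0 q0 md pq.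
set J := t - _ => E.
have Bt0 : 0 <= B * t by rewrite mulr_ge0// ltW.
have at0 : 0 <= a * t by rewrite mulr_ge0// ltW.
have Kt : K * t = a * t + 2 * (B * t) by rewrite /K; ring.
have JE : J = t * (1 - a * t / 2) by rewrite /J; ring.
have J0 : 0 <= J by rewrite JE mulr_ge0 ?(ltW t0)//; lra.
have Jt : J <= t by rewrite JE ger_pMr//; lra.
have qK : q ^+ 2 * (1 - K * t) <= m ^+ 2 + t * C.
  have fxA : fx - p <= `|fx - A| + B * q ^+ 2.
    by have := ler_norm (fx - A); lra.
  have r0 : 0 <= `|fx - A| + B * q ^+ 2 by rewrite addr_ge0// mulr_ge0// sqr_ge0.
  have Jf : (fx - p) * J <= t * (`|fx - A| + B * q ^+ 2).
    by rewrite (le_trans (ler_wpM2r J0 fxA))// mulrC ler_wpM2r.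
  by rewrite Kt /C; lra.
have m2 : m ^+ 2 <= d ^+ 2 / 4 * (1 + 3 * t).
  have /le_trans -> // : m ^+ 2 <= (d / 2 * (1 + t)) ^+ 2.
    by rewrite ler_sqr ?nnegrE ?mulr_ge0//; lra.
  have : 0 <= d ^+ 2 * (t * (1 - t)).
    by rewrite mulr_ge0 ?sqr_ge0 ?mulr_ge0 ?subr_ge0// ltW.
  by rewrite !expr2; lra.
rewrite leNgt; apply/negP => Qq.
have : Q ^+ 2 * (1 - K * t) <= q ^+ 2 * (1 - K * t).
  rewrite ler_wpM2r//; first by lra.
  by rewrite ler_sqr ?nnegrE ?(ltW Qq)// /Q addr_ge0 ?divr_ge0// ltW.
have de : 0 <= d * e by rewrite mulr_ge0// ltW.
have : Q ^+ 2 = d ^+ 2 / 4 + d * e + e ^+ 2 by rewrite /Q; field.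
lra.
Qed.

(** The two EVI bounds are added. As [p^2 + q^2 >= d^2 / 2], the squared distances drop by at most
    [d^2 / 2] times [a t + t^2 / 4]; the first term yields [a / 8 * d ^+ 2] and the second is
    [o(t)]. *)
Lemma midpoint_value_le (R : realType) (a d e t m n p q fx fy fp : R) :
  0 <= a -> 0 <= d -> 0 < e -> 0 < t -> a * t <= 1 ->
  t * (d ^+ 2 / 4 * (1 / 4 + a ^+ 2 / 2) + 1) < e ->
  0 <= p -> 0 <= q -> d <= p + q ->
  m ^+ 2 + n ^+ 2 <= 2^-1 * d ^+ 2 * (1 + t ^+ 2 / 4) ->
  (1 - a * t) * (p ^+ 2 / 2) - m ^+ 2 / 2 <= (fx - fp) * (t - a * t ^+ 2 / 2) ->
  (1 - a * t) * (q ^+ 2 / 2) - n ^+ 2 / 2 <= (fy - fp) * (t - a * t ^+ 2 / 2) ->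
  fp <= (fx + fy) / 2 + a / 8 * d ^+ 2 + e.
Proof.
move=> a0 d0 e0 t0 at1 te p0 q0 dpq mn; set J := t - _ => Ex Ey.
have JE : J = t * (1 - a * t / 2) by rewrite /J; ring.
have dpq2 : d ^+ 2 / 2 <= p ^+ 2 + q ^+ 2.
  have : d ^+ 2 <= (p + q) ^+ 2 by rewrite ler_sqr ?nnegrE ?addr_ge0.
  have := sqr_ge0 (p - q).
  by rewrite !expr2; clear; lra.
rewrite leNgt; apply/negP => fpe.
pose G := fp - ((fx + fy) / 2 + a / 8 * d ^+ 2).
have Ge : e <= G by rewrite /G; lra.
have J2 : t / 2 <= J by rewrite JE ler_pM2l//; lra.
have GJ : G * J <= d ^+ 2 / 8 * (t ^+ 2 / 4 + a ^+ 2 * t ^+ 2 / 2).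
  have -> : a ^+ 2 * t ^+ 2 / 2 = a * t - a * J by rewrite /J; field.
  have m0 : 0 <= 1 - a * t by rewrite subr_ge0.
  have := ler_wpM2l m0 dpq2.
  by move: mn Ex Ey; rewrite /G; clear; lra.
have : e * (t / 2) <= G * J.
  by rewrite ler_pM ?divr_ge0// ltW.
move=> /le_trans /(_ GJ).
rewrite (_ : d ^+ 2 / 8 * _ =
    t * (d ^+ 2 / 4 * (1 / 4 + a ^+ 2 / 2)) * (t / 2)); last by field.
rewrite ler_pM2r ?divr_gt0//.
by move: te t0; clear; lra.
Qed.

Section convexity.
Context {R : realType} {X : metricType R}.
Variables (a : R) (D : set X) (f : X -> R) (S : R -> X -> X).
Hypotheses (a_ge0 : 0 <= a) (HS : evi_semigroup a D f S).

(** EVI integrated up to one fixed time [T], with [a T <= 1 / 2], and tested with [v]. *)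
Lemma sg_quadratic_lower_bound (x : X) : D x ->
  exists A B : R, 0 <= B /\ forall v, D v -> A - B * mdist v x ^+ 2 <= f v.
Proof.
move=> Dx; have a0 := a_ge0.
pose T := (2 * a + 2)^-1.
have T0 : 0 < T by rewrite invr_gt0; lra.
have TE : T * (2 * a + 2) = 1 by rewrite mulVf// gt_eqF//; lra.
have aT : a * T <= 1 / 2 by lra.
pose J := T - a * T ^+ 2 / 2.
have J0 : 0 < J.
  rewrite /J (_ : _ - _ = T * (1 - a * T / 2)); last by ring.
  by rewrite mulr_gt0//; lra.
exists (f (S T x)), (2 * J)^-1; split; first by rewrite invr_ge0; lra.
move=> v Dv.
have aT1 : a * T <= 1 by lra.
have := sg_evi_integral a0 HS T0 aT1 (subset_closure Dx) Dv.
rewrite -/J (metric_sym x).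
set q := mdist (S T x) v; set r := mdist v x => E.
have q0 : 0 <= (1 - a * T) * (q ^+ 2 / 2).
  by rewrite mulr_ge0 ?divr_ge0 ?sqr_ge0//; lra.
rewrite -(ler_pM2r J0) mulrBl (_ : _ * r ^+ 2 * J = r ^+ 2 / 2); first by lra.
by field; rewrite gt_eqF.
Qed.

(** The bound must be uniform in [m], since the approximate midpoint will depend on [t]. EVI tested
    with [x] involves only [f x] and a lower bound on the energy after the flow, so no control of
    [f m] is required. *)
Lemma flow_near_midpoint (x : X) (d e : R) : D x -> 0 <= d -> 0 < e ->
  \forall t \near (0 : R)^'+, forall m, D m -> mdist m x <= d / 2 * (1 + t) ->
    mdist (S t m) x <= d / 2 + e.
Proof.
move=> Dx d0 e0; have a0 := a_ge0.
have [A [B [B0 lb]]] := sg_quadratic_lower_bound Dx.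
pose Q := d / 2 + e.
have Q0 : 0 < Q by rewrite /Q; lra.
pose K := a + 2 * B.
have K0 : 0 <= K by rewrite /K; lra.
pose C := 2 * `|f x - A|.
have C0 : 0 <= C by rewrite /C mulr_ge0.
have M0 : 0 < K * Q ^+ 2 + 3 * d ^+ 2 / 4 + C + 1.
  have : 0 <= K * Q ^+ 2 by rewrite mulr_ge0 ?sqr_ge0.
  by have := sqr_ge0 d; lra.
near=> t => m Dm mx.
have t0 : 0 < t by near: t; exact: nbhs_right_gt.
have t1 : t < 1 by near: t; exact: nbhs_right_lt.
have tK : t < (K + 1)^-1 by near: t; apply: nbhs_right_lt; rewrite invr_gt0; lra.
have tM : t < e ^+ 2 / (K * Q ^+ 2 + 3 * d ^+ 2 / 4 + C + 1).
  by near: t; apply: nbhs_right_lt; rewrite divr_gt0// exprn_gt0.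
move: tK; rewrite -div1r ltr_pdivlMr; last by lra.
move=> tK; move: tM; rewrite ltr_pdivlMr// => tM.
have at1 : a * t <= 1.
  by have := mulr_ge0 B0 (ltW t0); move: tK; rewrite /K; lra.
have cm : closure D m by exact: subset_closure.
have E := sg_evi_integral a0 HS t0 at1 cm Dx.
have Dp : D (S t m) by exact: (sg_dom HS).
exact: (midpoint_drift_le a0 B0 d0 e0 t0 t1 tK tM (mdist_ge0 _ _)
  (mdist_ge0 _ _) mx (lb _ Dp) E).
Unshelve. all: by end_near. Qed.

Hypothesis DL : approx_length_subset D.

(** An approximate midpoint [m] is regularised to [S t m], with the flow time [t] also used as the
    tolerance for [m]: the tolerance enters as [t^2] and disappears after division by [t]. *)
Lemma approx_convex_midpoint (x y : X) (e : R) : D x -> D y -> 0 < e ->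
  exists p, [/\ D p, mdist p x <= mdist x y / 2 + e,
    mdist p y <= mdist x y / 2 + e &
    f p <= (f x + f y) / 2 + a / 8 * mdist x y ^+ 2 + e].
Proof.
move=> Dx Dy e0; have a0 := a_ge0.
set d := mdist x y.
have d0 : 0 <= d by exact: mdist_ge0.
pose M := d ^+ 2 / 4 * (1 / 4 + a ^+ 2 / 2) + 1.
have M0 : 0 < M.
  by rewrite ltr_wpDl// mulr_ge0 ?addr_ge0 ?divr_ge0 ?sqr_ge0.
near (0 : R)^'+ => t.
have t0 : 0 < t by near: t; exact: nbhs_right_gt.
have t1 : t < 1 by near: t; exact: nbhs_right_lt.
have tM : t < e / M by near: t; apply: nbhs_right_lt; rewrite divr_gt0.
have ta : t < (a + 1)^-1 by near: t; apply: nbhs_right_lt; rewrite invr_gt0; lra.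
have tx : forall m, D m -> mdist m x <= d / 2 * (1 + t) ->
    mdist (S t m) x <= d / 2 + e by near: t; exact: flow_near_midpoint.
have ty : forall m, D m -> mdist m y <= d / 2 * (1 + t) ->
    mdist (S t m) y <= d / 2 + e by near: t; exact: flow_near_midpoint.
move: ta; rewrite -div1r ltr_pdivlMr; last by lra.
move=> ta; move: tM; rewrite ltr_pdivlMr// => tM.
have t01 : 0 < t < 1 by rewrite t0.
have [m Dm mxy] := DL Dx Dy t01.
rewrite -/d in mxy.
have dm : d <= mdist x m + mdist m y by exact: metric_triangle.
have mx : mdist m x <= d / 2 * (1 + t).
  by rewrite metric_sym; apply: approx_midpoint_le mxy => //; exact: mdist_ge0.
have my : mdist m y <= d / 2 * (1 + t).
  apply: (@approx_midpoint_le _ _ _ (mdist x m)) => //; rewrite ?mdist_ge0//.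
  - by rewrite addrC.
  - by rewrite addrC.
have cm : closure D m by exact: subset_closure.
exists (S t m); split.
- exact: (sg_dom HS).
- exact: tx.
- exact: ty.
have at1 : a * t <= 1 by lra.
have Ex := sg_evi_integral a0 HS t0 at1 cm Dx.
have Ey := sg_evi_integral a0 HS t0 at1 cm Dy.
have dp : d <= mdist (S t m) x + mdist (S t m) y.
  by rewrite (metric_sym _ x) metric_triangle.
rewrite (metric_sym x m) in mxy.
exact: (midpoint_value_le a0 d0 e0 t0 at1 tM (mdist_ge0 _ _) (mdist_ge0 _ _)
  dp mxy Ex Ey).
Unshelve. all: by end_near. Qed.

(** Starting from [y], each step takes an approximate midpoint between [x] and the previous point.
    Dyadic weights suffice because only [th] tending to zero is used later. *)
Lemma approx_convex_dyadic (x y : X) (k : nat) (e : R) : D x -> D y -> 0 < e ->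
  let th := 2^-1 ^+ k in
  exists p, [/\ D p, mdist p x <= th * mdist x y + e,
    mdist p y <= (1 - th) * mdist x y + e &
    f p <= (1 - th) * f x + th * f y
           + a / 2 * (th * (1 - th)) * mdist x y ^+ 2 + e].
Proof.
move=> Dx Dy; have a0 := a_ge0.
set d := mdist x y.
have d0 : 0 <= d by exact: mdist_ge0.
elim: k e => [|k IHk] e e0 th'.
  exists y; rewrite /th' expr0 mdistxx (metric_sym y) -/d.
  by split=> //; lra.
pose th : R := 2^-1 ^+ k.
have -> : th' = th / 2 by rewrite /th' exprS mulrC.
have th0 : 0 <= th by rewrite exprn_ge0// invr_ge0.
have th1 : th <= 1 by rewrite exprn_ile1 ?invr_ge0// invf_le1// ler1n.
have ad0 : 0 <= a * d by rewrite mulr_ge0.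
(* [M] collects the multiples of [c] lost in one halving; its last summand [e] ensures [c <= 1]. *)
pose M := 3 + a * (2 * d + 1) + e.
have M0 : 0 < M by rewrite /M; lra.
pose c := e / M.
have c0 : 0 < c by rewrite divr_gt0.
have cM : c * (3 + a * (2 * d + 1) + e) = e by rewrite /c -/M divfK// gt_eqF.
have ce0 : 0 < c * e by rewrite mulr_gt0.
have ca0 : 0 <= c * (a * (2 * d + 1)) by rewrite mulr_ge0//; [exact: ltW|lra].
have c1 : c <= 1.
  by rewrite /c ler_pdivrMr// mul1r /M; lra.
have [q [Dq qx qy fq]] := IHk c c0; rewrite -/th in qx qy fq.
have [p [Dp px pq fp]] := approx_convex_midpoint Dx Dq c0.
exists p; split => //.
- by move: px; rewrite (metric_sym x); lra.
- have := metric_triangle p q y.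
  by move: pq; rewrite (metric_sym x); lra.
have q2 : mdist x q ^+ 2 <= th ^+ 2 * d ^+ 2 + c * (2 * d + 1).
  have : mdist x q ^+ 2 <= (th * d + c) ^+ 2.
    rewrite ler_sqr ?nnegrE ?mdist_ge0 ?addr_ge0 ?(ltW c0) ?mulr_ge0//.
    by rewrite metric_sym.
  have : c * c <= c * 1 by rewrite ler_pM2l.
  have : c * d * th <= c * d * 1 by rewrite ler_wpM2l// mulr_ge0// ltW.
  by rewrite !expr2; lra.
have a80 : 0 <= a / 8 by lra.
have := ler_wpM2l a80 q2.
by move: fq fp; rewrite !expr2; lra.
Qed.

End convexity.

(** * Error of the scheme *)

(** With [al = a tau] and [be = eta tau], the hypothesis reads [4 gamma tau <= 1], and the
    exponential is [exp (2 gamma tau)], the square of the growth allowed per step. *)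
Lemma local_error_coef_le (R : realType) (al be : R) :
  0 <= al -> 0 <= be -> 12 * al + 8 * be <= 1 ->
  (expR al + al * expR al ^+ 2 / 2) * (1 + be / 2) ^+ 2
    <= expR (6 * al + 4 * be) * (1 - 2 * al - be).
Proof.
move=> al0 be0 albe; set th := expR al.
have th0 : 0 <= th by exact: expR_ge0.
have thal : th * (1 - al) <= 1.
  rewrite (le_trans (ler_wpM2l th0 (expR_ge1Dx (- al))))//.
  by rewrite -expRD subrr expR0.
have alth : al * th <= 1 / 12 * th by rewrite ler_wpM2r//; lra.
have th12 : th <= 12 / 11 by lra.
have al_th : al * th <= al * (12 / 11) by rewrite ler_wpM2l.
have alth2 : al * th * th <= al * (12 / 11) * (12 / 11).
  by rewrite ler_pM// mulr_ge0.
(* Both factors are majorised by affine functions, using [th <= 12 / 11] and [be <= 1 / 8]; the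
   comparison then reduces to polynomials. *)
have A : th + al * th ^+ 2 / 2 <= 1 + 17 / 10 * al by rewrite expr2; lra.
have be2 : be * be <= be * (1 / 8) by rewrite ler_wpM2l//; lra.
have B : (1 + be / 2) ^+ 2 <= 1 + 104 / 100 * be by rewrite expr2; lra.
have A0 : 0 <= th + al * th ^+ 2 / 2.
  by rewrite addr_ge0// divr_ge0// mulr_ge0// sqr_ge0.
rewrite (le_trans (ler_pM A0 (sqr_ge0 _) A B))//.
have C0 : 0 <= 1 - 2 * al - be by lra.
rewrite (le_trans _ (ler_wpM2r C0 (expR_ge1Dx _)))//.
have al2 : al * al <= al * (1 / 12) by rewrite ler_wpM2l//; lra.
have albe2 : al * be <= 1 / 12 * be by rewrite ler_wpM2r//; lra.
lra.
Qed.

Section one_step.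
Context {R : realType} {X : metricType R}.
Variables (a : R) (D : set X) (f : X -> R) (S : R -> X -> X).
Hypotheses (a_ge0 : 0 <= a) (HS : evi_semigroup a D f S).
Hypothesis DL : approx_length_subset D.
Variables (tau eta : R) (x y : X).
Hypotheses (tau_gt0 : 0 < tau) (eta_ge0 : 0 <= eta) (Dx : D x) (Dy : D y).
Hypothesis ymin : forall v, D v ->
  (2 * tau)^-1 * mdist y x ^+ 2 + f y <=
  (2 * tau)^-1 * mdist v x ^+ 2 + f v + eta / 2 * mdist y x * mdist v y.

(** Expanding [(d + r)^2] in the minimality against a point at distance [r] leaves the linear term
    [d r / tau]; the quadratic remainder is at most [e r] for small [r]. *)
Lemma minimizer_slope_le : slope_le D f y ((tau^-1 + eta / 2) * mdist y x).
Proof.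
move=> e e0; have tau0 := tau_gt0.
set d := mdist y x.
have d0 : 0 <= d by exact: mdist_ge0.
have et0 : 0 < 2 * tau * e by rewrite mulr_gt0//; lra.
near=> v => Dv.
have yv : mdist y v < 2 * tau * e.
  by near: v; exact: (metricType_numDomainType.cvgr_dist_lt cvg_id et0).
have := ymin Dv; rewrite -/d (metric_sym v y).
set r := mdist y v in yv *.
have r0 : 0 <= r by exact: mdist_ge0.
have vx : mdist v x <= d + r.
  by rewrite addrC /r (metric_sym y) metric_triangle.
pose c := (2 * tau)^-1.
have c0 : 0 < c by rewrite invr_gt0; lra.
have tauc : tau^-1 = 2 * c by rewrite /c invfM mulrA divff ?mul1r.
have vx2 : c * mdist v x ^+ 2 <= c * (d + r) ^+ 2.
  by rewrite ler_pM2l// ler_sqr ?nnegrE ?mdist_ge0 ?addr_ge0.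
have cr : c * r <= e.
  have : c * r <= c * (2 * tau * e) by rewrite ler_pM2l// ltW.
  by rewrite mulrA /c mulVf ?mul1r// mulf_neq0// gt_eqF.
have := ler_wpM2r r0 cr.
by rewrite tauc -/c; move: vx2; rewrite !expr2; lra.
Unshelve. all: by end_near. Qed.

(* Competitors at distance [th * mdist x y] from [y] on an approximate geodesic
   from [y] to [x], in the limit [th -> 0]: this gains a factor two over
   the competitor [x] itself. *)
Lemma minimizer_energy_gap :
  f y + (tau^-1 - a / 2 - eta / 2) * mdist y x ^+ 2 <= f x.
Proof.
have tau0 := tau_gt0; have a0 := a_ge0; have eta0 := eta_ge0.
set d := mdist y x.
have d0 : 0 <= d by exact: mdist_ge0.
pose c := (2 * tau)^-1.
have c0 : 0 < c by rewrite invr_gt0; lra.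
have tauc : tau^-1 = 2 * c by rewrite /c invfM mulrA divff ?mul1r.
have cd0 : 0 <= c * d ^+ 2 by rewrite mulr_ge0 ?sqr_ge0// ltW.
have cd1 : 0 <= c * d by rewrite mulr_ge0// ltW.
have ed0 : 0 <= eta * d by rewrite mulr_ge0.
(* Since [1 - (1 - th)^2 = th (2 - th)], dividing the minimality inequality by [th] leaves the
   coefficient [2 - th], which tends to the announced factor two. *)
have step (k : nat) : c * (2 - 2^-1 ^+ k) * d ^+ 2 + f y
    <= f x + a / 2 * (1 - 2^-1 ^+ k) * d ^+ 2 + eta / 2 * d ^+ 2.
  set th := 2^-1 ^+ k.
  have th0 : 0 < th by rewrite exprn_gt0// invr_gt0.
  have th1 : th <= 1 by rewrite exprn_ile1 ?invr_ge0// invf_le1// ler1n.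
  rewrite -(ler_pM2l th0); apply/ler_addgt0Pr => e e0.
  pose M := c * (2 * d + 1) + 1 + eta / 2 * d + e.
  have cd2 : 0 < c * (2 * d + 1) by rewrite mulr_gt0//; lra.
  have M0 : 0 < M by rewrite /M; lra.
  pose k' := e / M.
  have k0 : 0 < k' by rewrite divr_gt0.
  have kM : k' * (c * (2 * d + 1) + 1 + eta / 2 * d + e) = e.
    by rewrite /k' -/M divfK// gt_eqF.
  have ke0 : 0 < k' * e by rewrite mulr_gt0.
  have k1 : k' <= 1 by rewrite /k' ler_pdivrMr// mul1r /M; lra.
  have [p [Dp py px fp]] := approx_convex_dyadic a_ge0 HS DL k Dy Dx k0.
  rewrite -/th -/d in py px fp.
  have := ymin Dp; rewrite -/d -/c => pmin.
  have px2 : c * mdist p x ^+ 2 <= c * ((1 - th) * d + k') ^+ 2.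
    rewrite ler_pM2l// ler_sqr ?nnegrE ?mdist_ge0// addr_ge0 ?(ltW k0)//.
    by rewrite mulr_ge0// subr_ge0.
  have etapy : eta / 2 * d * mdist p y <= eta / 2 * d * (th * d + k').
    by rewrite ler_wpM2l// mulr_ge0//; lra.
  have ck : c * (k' * k') <= c * k' by rewrite ler_pM2l// ger_pMr.
  have cdk : 0 <= c * d * k' * th by rewrite !(mulr_ge0 _ (ltW th0), mulr_ge0 _ (ltW k0)).
  by move: pmin px2; rewrite !expr2; lra.
rewrite tauc; apply/ler_addgt0Pr => e e0.
(* Because [2^k > k], this [k] makes [th c d^2] at most [e]. *)
pose k := (Num.truncn (c * d ^+ 2 / e)).+1.
have := step k; set th := 2^-1 ^+ k.
have th0 : 0 < th by rewrite exprn_gt0// invr_gt0.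
have : th * (c * d ^+ 2) <= e.
  rewrite /th exprVn mulrC ler_pdivrMr ?exprn_gt0// [leRHS]mulrC -ler_pdivrMr//.
  apply: (@le_trans _ _ k%:R); first by rewrite ltW// /k truncnS_gt.
  by rewrite -natrX ler_nat ltnW// ltn_expl.
have : 0 <= a / 2 * th * d ^+ 2.
  by rewrite !mulr_ge0 ?sqr_ge0 ?invr_ge0// ltW.
lra.
Qed.

(** In EVI tested with [y], [f y - f (S t x)] splits into [f y - f x], bounded by the energy gap,
    and [f x - f (S t x)], bounded linearly in [t] by slope and speed. The gap outweighs the initial
    [d^2 / 2], so the new slope enters with a negative sign and the bound can telescope. *)
Lemma local_error (s : R) : 0 <= s -> slope_le D f x s ->
  12 * (a * tau) + 8 * (eta * tau) <= 1 ->
  mdist (S tau x) y ^+ 2 <=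
    tau ^+ 2 * ((1 - 2 * (a * tau) - eta * tau)
      / ((1 - a * tau) * (1 + eta * tau / 2) ^+ 2))
    * (expR (6 * (a * tau) + 4 * (eta * tau)) * s ^+ 2
       - ((tau^-1 + eta / 2) * mdist y x) ^+ 2).
Proof.
move=> s0 xs small.
have tau0 := tau_gt0; have a0 := a_ge0; have eta0 := eta_ge0.
set al := a * tau in small *; set be := eta * tau in small *.
have al0 : 0 <= al by rewrite mulr_ge0// ltW.
have be0 : 0 <= be by rewrite mulr_ge0// ltW.
have cx : closure D x by exact: subset_closure.
set d := mdist y x.
pose th := expR al.
have th0 : 0 <= th by exact: expR_ge0.
(* [k t] bounds [s r + a r^2 / 2] when [r <= t th s] and [a t <= al]. *)
pose k := s ^+ 2 * (th + al * th ^+ 2 / 2).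
have k0 : 0 <= k.
  by rewrite mulr_ge0 ?sqr_ge0// addr_ge0// divr_ge0// mulr_ge0// sqr_ge0.
pose c := - ((tau^-1 - a / 2 - eta / 2) * d ^+ 2).
have al1 : al <= 1 by lra.
have gron := gronwall_affine (c := c) a0 k0 tau0 al1
  (sg_within_mdistl HS (v := y) tau0 cx).
have {}gron : (1 - al) * (mdist (S tau x) y ^+ 2 / 2)
    <= d ^+ 2 / 2 + c * (tau - a * tau ^+ 2 / 2) + k * tau ^+ 2 / 2.
  move: gron; rewrite (sg_init HS)// (metric_sym x) -/d; apply.
  move=> t /andP[t0 tt]; split; first by rewrite divr_ge0// sqr_ge0.
  apply: dini_le_mono (sg_evi HS t0 cx Dy).
  have fS := slope_le_global a_ge0 HS Dx s0 xs (sg_dom HS t0 cx).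
  have rt := sg_speed a_ge0 HS Dx s0 xs (ltW t0).
  rewrite metric_sym in fS.
  set r := mdist _ x in fS rt.
  have r0 : 0 <= r by exact: mdist_ge0.
  have {}rt : r <= t * th * s.
    rewrite (le_trans rt)// ler_wpM2r// ler_wpM2l//; first exact: ltW.
    by rewrite ler_expR ler_wpM2l// ltW.
  have srt := ler_wpM2l s0 rt.
  have r2 : r ^+ 2 <= (t * th * s) ^+ 2 by rewrite ler_sqr ?nnegrE// (le_trans r0).
  have ar2 : a / 2 * r ^+ 2 <= a / 2 * (t * th * s) ^+ 2.
    by rewrite ler_wpM2l// divr_ge0.
  have att : a * t <= al by rewrite ler_wpM2l// ltW.
  have pos : 0 <= t * (th * s) ^+ 2 by rewrite mulr_ge0 ?sqr_ge0// ltW.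
  have := ler_wpM2r pos att.
  have gap := minimizer_energy_gap.
  have -> : k * t = s * (t * th * s) + al * (t * (th * s) ^+ 2) / 2.
    by rewrite /k; field.
  by move: fS; rewrite /c -/d in gap *; rewrite !expr2 in ar2 *; lra.
(* [B] is chosen so that the terms in [d^2] on both sides agree exactly. *)
pose B := (1 - 2 * al - be) / ((1 - al) * (1 + be / 2) ^+ 2).
rewrite -/B.
have al10 : 0 < 1 - al by lra.
have be10 : 0 < 1 + be / 2 by lra.
have tneq : tau != 0 by rewrite gt_eqF.
have Bd : tau ^+ 2 * B * ((tau^-1 + eta / 2) * d) ^+ 2
    = (1 - 2 * al - be) * d ^+ 2 / (1 - al).
  rewrite /B (_ : (tau^-1 + eta / 2) = (1 + be / 2) / tau); last first.
    by rewrite /be; field.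
  by field; rewrite tneq !gt_eqF//; lra.
have cE : c * (tau - a * tau ^+ 2 / 2) <= - (1 - al - be / 2) * d ^+ 2.
  have -> : c * (tau - a * tau ^+ 2 / 2)
      = - ((1 - al / 2 - be / 2) * (1 - al / 2)) * d ^+ 2.
    by rewrite /c /al /be; field.
  rewrite ler_wpM2r ?sqr_ge0// lerN2.
  have : 0 <= al * be by rewrite mulr_ge0.
  by have := sqr_ge0 al; rewrite expr2; lra.
rewrite mulrBr Bd -(ler_pM2l al10) mulrBr.
rewrite (_ : (1 - al) * ((1 - 2 * al - be) * d ^+ 2 / (1 - al))
  = (1 - 2 * al - be) * d ^+ 2); last first.
  by rewrite mulrC divfK// gt_eqF.
suff : k * tau ^+ 2 <= (1 - al) * (tau ^+ 2 * B *
    (expR (6 * al + 4 * be) * s ^+ 2)) by move: gron cE; lra.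
rewrite (_ : (1 - al) * _ = s ^+ 2 * tau ^+ 2 *
  (expR (6 * al + 4 * be) * (1 - 2 * al - be) / (1 + be / 2) ^+ 2)); last first.
  by rewrite /B; field; rewrite !gt_eqF//; lra.
rewrite /k (mulrAC (s ^+ 2)); apply: ler_wpM2l.
  by rewrite mulr_ge0 ?sqr_ge0.
rewrite ler_pdivlMr ?exprn_gt0//.
exact: local_error_coef_le.
Qed.

End one_step.

(** By AM-GM, [2 u v <= p + n q]. This is Cauchy-Schwarz in inductive form, and it makes [N] steps
    cost [sqrt N] rather than [N]. *)
Lemma sqr_add_le (R : realType) (n : nat) (u v p q : R) :
  0 <= u -> 0 <= v -> 0 <= p -> u ^+ 2 <= n%:R * p -> v ^+ 2 <= q ->
  (u + v) ^+ 2 <= n.+1%:R * (p + q).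
Proof.
move=> u0 v0 p0 up vq.
have n0 : (0 : R) <= n%:R by [].
have q0 : 0 <= q by rewrite (le_trans _ vq)// sqr_ge0.
have uv : u * v <= (p + n%:R * q) / 2.
  have pq0 : 0 <= (p + n%:R * q) / 2.
    by rewrite divr_ge0// addr_ge0// mulr_ge0.
  rewrite -ler_sqr ?nnegrE ?pq0 ?mulr_ge0// exprMn.
  have := ler_pM (sqr_ge0 u) (sqr_ge0 v) up vq.
  have := sqr_ge0 (p - n%:R * q).
  by rewrite !expr2; lra.
by rewrite -natr1 sqrrD; lra.
Qed.

(** [P n] is the sum of the first [n] local bounds, each amplified by [G] at every later step; it
    telescopes. The induction proves [E n ^+ 2 <= n P n]. *)
Lemma global_error (R : realType) (X : metricType R) (a : R) (D : set X)
    (f : X -> R) (S : R -> X -> X) (tau eta : R) (U : nat -> X) (s0 : R) :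
  0 <= a -> evi_semigroup a D f S -> approx_length_subset D ->
  0 < tau -> 0 <= eta -> 4 * (2 * eta + 3 * a) * tau <= 1 ->
  (forall n, D (U n)) ->
  (forall n v, D v ->
    (2 * tau)^-1 * mdist (U n.+1) (U n) ^+ 2 + f (U n.+1) <=
    (2 * tau)^-1 * mdist v (U n) ^+ 2 + f v
      + eta / 2 * mdist (U n.+1) (U n) * mdist v (U n.+1)) ->
  0 <= s0 -> slope_le D f (U 0%N) s0 ->
  forall n : nat, mdist (S (n%:R * tau) (U 0%N)) (U n) <=
    Num.sqrt (tau * (n%:R * tau)) * expR ((2 * eta + 3 * a) * (n%:R * tau)) * s0.
Proof.
move=> a0 HS DL tau0 eta0 small DU minU s00 Us0.
pose al := a * tau; pose be := eta * tau.
have al0 : 0 <= al by rewrite mulr_ge0// ltW.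
have be0 : 0 <= be by rewrite mulr_ge0// ltW.
have albe : 12 * al + 8 * be <= 1 by rewrite /al /be; lra.
pose G := expR (6 * al + 4 * be).
pose B := (1 - 2 * al - be) / ((1 - al) * (1 + be / 2) ^+ 2).
have al1 : 0 < 1 - al by lra.
have be1 : 1 <= (1 + be / 2) ^+ 2 by rewrite expr2; have := sqr_ge0 be; lra.
have albe1 : 0 < (1 - al) * (1 + be / 2) ^+ 2.
  by rewrite mulr_gt0// (lt_le_trans _ be1).
have B1 : B <= 1.
  rewrite ler_pdivrMr// mul1r.
  by have := ler_wpM2l (ltW al1) be1; lra.
have B0 : 0 <= B by rewrite divr_ge0 ?(ltW albe1)//; lra.
have G0 : 0 <= G by exact: expR_ge0.
(* At the initial point the given slope is used, afterwards the bound that minimality provides. *)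
pose sl n := if n is m.+1 then (tau^-1 + eta / 2) * mdist (U m.+1) (U m) else s0.
have sl0 n : 0 <= sl n.
  by case: n => [|n]//=; rewrite mulr_ge0 ?mdist_ge0// addr_ge0 ?divr_ge0// invr_ge0 ltW.
have slP n : slope_le D f (U n) (sl n).
  by case: n => [|n]//=; apply: minimizer_slope_le => //; exact: minU.
pose P n := tau ^+ 2 * B * (G ^+ n * s0 ^+ 2 - sl n ^+ 2).
pose E n := mdist (S (n%:R * tau) (U 0%N)) (U n).
have cU n : closure D (U n) by exact: subset_closure.
have EP n : 0 <= P n /\ E n ^+ 2 <= n%:R * P n.
  elim: n => [|n [P0 IHn]].
    by rewrite /P /E !mul0r expr0 mul1r subrr mulr0 (sg_init HS)// mdistxx expr0n.
  have Pn1 : P n.+1 = G * P n + tau ^+ 2 * B * (G * sl n ^+ 2 - sl n.+1 ^+ 2).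
    by rewrite /P (exprS G); ring.
  have loc := local_error a0 HS DL tau0 eta0 (DU n) (DU n.+1) (minU n) (sl0 n)
    (slP n) albe.
  rewrite -/al -/be -/G -/B -[_ * mdist _ _]/(sl n.+1) in loc.
  have ntau0 : 0 <= n%:R * tau by rewrite mulr_ge0// ltW.
  have En1 : E n.+1 <= expR al * E n + mdist (S tau (U n)) (U n.+1).
    rewrite /E -natr1 mulrDl mul1r (sg_semigroup HS)//; last exact: ltW.
    rewrite (le_trans (metric_triangle _ (S tau (U n)) _))// lerD2r.
    apply: (sg_contraction a0 HS) => //; first exact: ltW.
    exact: (sg_closure HS).
  have Ean : (expR al * E n) ^+ 2 <= n%:R * (G * P n).
    rewrite exprMn (mulrCA n%:R); apply: ler_pM; rewrite ?sqr_ge0//.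
    by rewrite -expRM_natl ler_expR; lra.
  have EE : E n.+1 ^+ 2 <= n.+1%:R * P n.+1.
    rewrite Pn1 (le_trans _ (sqr_add_le _ _ _ Ean loc))//; last first.
    - by rewrite mulr_ge0.
    - exact: mdist_ge0.
    - by rewrite mulr_ge0 ?expR_ge0 ?mdist_ge0.
    rewrite ler_sqr ?nnegrE ?mdist_ge0// addr_ge0 ?mdist_ge0//.
    by rewrite mulr_ge0 ?expR_ge0 ?mdist_ge0.
  (* The sign of the difference [P n.+1] is read off from the square it bounds. *)
  split=> //.
  have n10 : (0 : R) < n.+1%:R by [].
  by rewrite -(pmulr_rge0 _ n10) (le_trans _ EE)// sqr_ge0.
move=> n; have [P0] := EP n; rewrite -/(E n) => En.
have ntau0 : 0 <= n%:R * tau by rewrite mulr_ge0// ltW.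
rewrite -ler_sqr ?nnegrE ?mdist_ge0 ?mulr_ge0 ?expR_ge0 ?sqrtr_ge0//.
rewrite (le_trans En)// !exprMn sqr_sqrtr; last by rewrite mulr_ge0// ltW.
rewrite -expRM_natl (_ : 2%:R * _ = n%:R * (6 * al + 4 * be)); last first.
  by rewrite /al /be; ring.
rewrite expRM_natl -/G.
have -> : tau * (n%:R * tau) * G ^+ n * s0 ^+ 2
    = n%:R * (tau ^+ 2 * (G ^+ n * s0 ^+ 2)) by ring.
rewrite ler_wpM2l// /P -mulrA ler_wpM2l ?sqr_ge0//.
have Gs0 : 0 <= G ^+ n * s0 ^+ 2 by rewrite mulr_ge0 ?sqr_ge0 ?exprn_ge0.
(* The final slope is dropped, and then [B <= 1]. *)
have := ler_wpM2l B0 (_ : G ^+ n * s0 ^+ 2 - sl n ^+ 2 <= G ^+ n * s0 ^+ 2).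
move=> /(_ ltac:(by rewrite gerBl sqr_ge0))/le_trans; apply.
by rewrite -[leRHS]mul1r ler_wpM2r.
Qed.

(** * Reduction to real-valued functionals *)

Lemma limf_esup_lt_near (T : choiceType) (X : filteredType T) (R : realType)
    (g : X -> \bar R) (F : set_system X) (FF : Filter F) (c : \bar R) :
  (limf_esup g F < c)%E -> \forall x \near F, (g x < c)%E.
Proof.
move=> /ereal_inf_lt[_ [V FV <-] Vc].
apply: filterS FV => x Vx; apply: le_lt_trans Vc.
by apply: ereal_sup_ubound; exists x.
Qed.

Lemma proper_finE (R : realType) (X : Type) (phi : X -> \bar R) (x : X) :
  proper_functional phi -> Dom phi x -> phi x = (fine (phi x))%:E.
Proof.
move=> [phioo _]; rewrite /Dom/= => phix.
by rewrite fineK// fin_real// phioo.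
Qed.

Lemma upper_right_derivative_dini (R : realType) (z : R -> R) (t c : R) :
  (upper_right_derivative z t <= c%:E)%E -> dini_le z t c.
Proof.
move=> zc e e0.
have : (upper_right_derivative z t < (c + e)%:E)%E.
  by rewrite (le_lt_trans zc)// lte_fin ltrDl.
move=> /limf_esup_lt_near nz; near=> h.
have h0 : 0 < h by near: h; exact: nbhs_right_gt.
have : (((z (t + h) - z t) / h)%:E < (c + e)%:E)%E by near: h; exact: nz.
by rewrite lte_fin ltr_pdivrMr// mulrC => /ltW.
Unshelve. all: by end_near. Qed.

(** All energies compared lie in [Dom phi], so properness lets [fine] replace the extended values
    there. *)
Lemma EVI_flow_semigroup (R : realType) (X : metricType R) (phi : X -> \bar R)
    (lambda : R) (S : R -> X -> X) :
  proper_functional phi -> lower_semicontinuous phi ->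
  EVI_flow lambda phi (closure (Dom phi)) S ->
  evi_semigroup (- lambda) (Dom phi) (fine \o phi) S.
Proof.
move=> phip phil ES; split.
- by move=> t x t0 cx; exact: (evi_dom (flow_evi ES cx)).
- move=> t x t0 cx; have := evi_continuous (flow_evi ES cx).
  by rewrite continuous_open_subspace; [apply; rewrite inE|exact: open_gt].
- by move=> x cx; have := flow_lim0 ES cx; rewrite (flow_init ES cx).
- exact: (flow_semigroup ES).
- exact: (flow_init ES).
- move=> x e Dx e0.
  have [|V xV Ve] := phil x (fine (phi x) - e).
    by rewrite [ltRHS](proper_finE phip Dx) lte_fin ltrBlDr ltrDl.
  apply: filterS xV => y /Ve + Dy.
  by rewrite [ltRHS](proper_finE phip Dy) lte_fin.
- move=> x v t t0 cx Dv.
  have Dt : Dom phi (S t x) by exact: (evi_dom (flow_evi ES cx)).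
  have := evi_ineq (flow_evi ES cx) t0 Dv.
  rewrite (proper_finE phip Dv) (proper_finE phip Dt).
  set z := fun s : R => mdist (S s x) v ^+ 2.
  set fv := fine (phi v); set ft := fine (phi (S t x)) => zE.
  have zc : (upper_right_derivative z t <= (2 * (fv - ft) - lambda * z t)%:E)%E.
    (* The value [+oo] contradicts EVI with finite energies; [-oo] satisfies any bound. *)
    move: zE; case: upper_right_derivative => [r| |].
    + by rewrite -EFinM -!EFinD !lee_fin /z; lra.
    + by rewrite gt0_muley ?lte_fin ?invr_gt0.
    + by rewrite leNye.
  move=> e e0; have e20 : 0 < 2 * e by rewrite mulr_gt0.
  apply: filterS (upper_right_derivative_dini zc e20) => h.
  by rewrite /= -/fv -/ft /z; lra.
Qed.

Lemma metric_slope_ge0 (R : realType) (X : metricType R) (phi : X -> \bar R)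
    (x : X) : (0 <= metric_slope phi x)%E.
Proof.
rewrite /metric_slope; case: ifPn => // _; case: ifPn => // /asboolPn iso.
(* Along an improper filter the limit superior would be [-oo]; non-isolation excludes this. *)
apply: limf_esup_ge0 => [x0|y].
  apply: iso; split; first by rewrite inE.
  exists [set x]; last by rewrite setIT.
  move: x0; rewrite /dnbhs /within /= nearE => x0.
  by apply: filterS x0 => y yx; apply: contrapT => /eqP /yx.
by rewrite mule_ge0// ?le_max ?lexx ?orbT// lee_fin invr_ge0 mdist_ge0.
Qed.

Lemma metric_slope_slope_le (R : realType) (X : metricType R)
    (phi : X -> \bar R) (x : X) (s : R) :
  proper_functional phi -> Dom phi x -> metric_slope phi x = s%:E ->
  slope_le (Dom phi) (fine \o phi) x s.
Proof.
move=> phip Dx; rewrite /metric_slope ifF; last by apply/negbTE/negPn; rewrite inE.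
case: ifPn => [/asboolP[_ [V xV]] | _ slope e e0].
  rewrite setIT => Vx [<-] e e0.
  apply: filterS xV => y; rewrite Vx => -> _ /=.
  by rewrite subrr mdistxx mulr0.
have : (limf_esup (fun y : X => Order.max (phi x - phi y) 0 *
    (mdist x y)^-1%:E) x^' < (s + e)%:E)%E by rewrite slope lte_fin ltrDl.
move=> /limf_esup_lt_near; rewrite /dnbhs near_withinE => nslope.
apply: filterS nslope => y yslope Dy /=.
have [->|yx] := eqVneq y x; first by rewrite subrr mdistxx mulr0.
have := yslope yx.
rewrite (proper_finE phip Dx) (proper_finE phip Dy) /=.
have d0 : 0 < mdist x y by rewrite mdist_gt0 eq_sym.
rewrite -EFinB -EFin_max -EFinM lte_fin ltr_pdivrMr// => /ltW.
by apply: le_trans; rewrite le_max lexx.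
Qed.

(** With [T = step_time tau t], the distance is split at [S t (U 0)] and [S T (U 0)]: contraction
    handles the first piece, the speed of the flow over [T - t] the second, and the error of the
    scheme at the grid time [T] the third. *)
Theorem corollary5p6 (R : realType) (X : metricType R) (phi : X -> \bar R)
    (lambda : R) (S : R -> X -> X) (tau eta : R) (U : nat -> X) :
  proper_functional phi ->
  lower_semicontinuous phi ->
  approx_length_subset (Dom phi) ->
  lambda <= 0 ->
  EVI_flow lambda phi (closure (Dom phi)) S ->
  0 < tau -> 0 <= eta ->
  let gamma := 2 * eta - 3 * lambda in
  4 * gamma * tau <= 1 ->
  minimizing_movement phi tau eta U ->
  forall u0, closure (Dom phi) u0 ->
  forall t : R, 0 < t ->
  ((mdist (S t u0) (interpolant tau U t))%:E
   <= (expR (- (lambda * t)) * mdist u0 (U 0%N))%:E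
      + ((Num.sqrt (tau * step_time tau t) + step_time tau t - t)
          * expR (gamma * step_time tau t))%:E
        * metric_slope phi (U 0%N))%E.
Proof.
move=> phip phil DL lambda0 ES tau0 eta0 gamma small MM u0 cu0 t t0.
have HS := EVI_flow_semigroup phip phil ES.
have a0 : 0 <= - lambda by rewrite oppr_ge0.
have [tT _] := step_time_min tau0 (ltW t0).
set T := step_time tau t in tT *.
have T0 : 0 < T by exact: lt_le_trans tT.
have DU := mm_dom MM.
have sqrtT0 : 0 < Num.sqrt (tau * T) by rewrite sqrtr_gt0 mulr_gt0.
(* Strict positivity makes the right side [+oo] when the slope is infinite, where a zero coefficient
   would give zero. *)
have coef0 : 0 < (Num.sqrt (tau * T) + T - t) * expR (gamma * T).
  by rewrite mulr_gt0 ?expR_gt0//; lra.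
have := metric_slope_ge0 phi (U 0%N).
case slopeE : (metric_slope phi (U 0%N)) => [s| |] // s0; last first.
  by rewrite gt0_muley ?lte_fin// addey ?leey.
rewrite lee_fin in s0.
rewrite -EFinM -EFinD lee_fin.
have Us := metric_slope_slope_le phip (DU 0%N) slopeE.
have gammaE : gamma = 2 * eta + 3 * - lambda by rewrite /gamma; ring.
have minU n v : Dom phi v ->
    (2 * tau)^-1 * mdist (U n.+1) (U n) ^+ 2 + (fine \o phi) (U n.+1) <=
    (2 * tau)^-1 * mdist v (U n) ^+ 2 + (fine \o phi) v
      + eta / 2 * mdist (U n.+1) (U n) * mdist v (U n.+1).
  move=> Dv; have := mm_min MM n Dv.
  rewrite (proper_finE phip Dv) (proper_finE phip (DU n.+1)).
  by rewrite -!EFinD lee_fin.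
have small' : 4 * (2 * eta + 3 * - lambda) * tau <= 1 by rewrite -gammaE.
have glob := global_error a0 HS DL tau0 eta0 small' DU minU s0 Us
  (step_index tau t).
rewrite -gammaE -/(step_time tau t) -/T -/(interpolant tau U t) in glob.
have cU : closure (Dom phi) (U 0%N) by exact: subset_closure.
have contr := sg_contraction a0 HS (ltW t0) cu0 cU.
have Tt0 : 0 <= T - t by rewrite subr_ge0.
have cUT : closure (Dom phi) (S (T - t) (U 0%N)) by exact: (sg_closure HS).
have time : mdist (S t (U 0%N)) (S T (U 0%N)) <= (T - t) * expR (gamma * T) * s.
  have -> : S T (U 0%N) = S t (S (T - t) (U 0%N)).
    by rewrite -(sg_semigroup HS) ?(ltW t0)// subrK.
  rewrite (le_trans (sg_contraction a0 HS (ltW t0) cU cUT))// metric_sym.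
  have := sg_speed a0 HS (DU 0%N) s0 Us Tt0.
  move=> /(ler_wpM2l (expR_ge0 (- lambda * t)))/le_trans; apply.
  (* The exponents over [t] and [T - t] add up to [- lambda T], which is at most [gamma T]. *)
  rewrite mulrA ler_wpM2r// mulrCA ler_wpM2l// -expRD ler_expR.
  rewrite -mulrDr (addrC t) subrK ler_wpM2r ?(ltW T0)// /gamma; lra.
have := metric_triangle (S t u0) (S t (U 0%N)) (interpolant tau U t).
have := metric_triangle (S t (U 0%N)) (S T (U 0%N)) (interpolant tau U t).
by move: contr; rewrite mulNr; lra.
Qed.
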